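(* For $i=1,2$, let $(W_i,S_i)$ be an arbitrary Coxeter system (possibly of infinite rank) with Coxeter graph $\Gamma_i$, let $G_i$ be a group, let $\rho_i:G_i\to\mathrm{Aut}\,\Gamma_i$ be a group homomorphism, and let $W_i\rtimes G_i$ be the corresponding semidirect product. Let $f:W_1\rtimes G_1\to W_2\rtimes G_2$ be a group isomorphism. Then $f$ maps $W_1(\mathcal{O}_{\rho_1})\rtimes\langle (G_1)_{\rho_1}\rangle$ onto $W_2(\mathcal{O}_{\rho_2})\rtimes\langle (G_2)_{\rho_2}\rangle$.
   Context: A Coxeter system $(W,S)$: $W$ is a group with presentation $\langle S\mid (st)^{m_{s,t}}=1 \text{ for } s,t\in S \text{ with } m_{s,t}<\infty\rangle$, where $m_{s,t}=m_{t,s}\in\{1,2,\dots\}\cup\{\infty\}$ and $m_{s,t}=1$ iff $s=t$. $S$ may be infinite. The Coxeter graph $\Gamma$ has vertex set $S$, with $s,t$ joined by an edge labelled $m_{s,t}$ iff $m_{s,t}\ge 3$. $\mathrm{Aut}\,\Gamma$ is the group of label-preserving graph automorphisms; each $\tau\in\mathrm{Aut}\,\Gamma$ extends uniquely to a group automorphism of $W$, also denoted $\tau$. Given a homomorphism $\rho:G\to\mathrm{Aut}\,\Gamma$, $g\mapsto\rho_g$, in $W\rtimes G$ one has $(wg)(w'g')=w\rho_g(w')\cdot gg'$. For $I\subseteq S$, $W_I=\langle I\rangle$. An irreducible component of $W$ is a subgroup $W_I$ with $I$ (the vertex set of) a connected component of $\Gamma$. $\mathcal{C}_W^{\mathrm{fin}}$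 is the set of the finite irreducible components of $W$. The $G$-action permutes $\mathcal{C}_W^{\mathrm{fin}}$, and $\rho^\dagger:G\to\mathrm{Sym}(\mathcal{C}_W^{\mathrm{fin}})$ is the induced permutation representation. For a set $\mathcal{C}$ of irreducible components, $W(\mathcal{C})$ is the subgroup of $W$ generated by (the restricted direct product of) the components in $\mathcal{C}$. An element $x$ of a group $H$ is almost central in $H$ if its centralizer $Z_H(x)$ has finite index in $H$; $H_{\mathrm{ACI}}$ is the set of almost central involutions (elements of order exactly $2$) in $H$. $\mathcal{O}_\rho\subseteq\mathcal{C}_W^{\mathrm{fin}}$ is the union of the $\rho^\dagger(G)$-orbits in $\mathcal{C}_W^{\mathrm{fin}}$ with finite cardinalities. $G_\rho$ is the set of all $h\in G_{\mathrm{ACI}}$ such that $\rho_h$ is the identity on all irreducible components of $W$ except a finite number of finite irreducible components. $\langle G_\rho\rangle$ is the subgroup of $G$ generated by $G_\rho$. *)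

(* Defs.v *)
From HB Require Import structures.
From Stdlib Require Import Relation_Operators.
From mathcomp Require Import all_boot.
From mathcomp Require Import boolp classical_sets cardinality.

Set Implicit Arguments.
Unset Strict Implicit.
Unset Printing Implicit Defensive.

Local Open Scope classical_set_scope.
Local Open Scope group_scope.

Definition is_subgroup (G : groupType) (H : set G) : Prop :=
  [/\ H 1, forall x y, H x -> H y -> H (x * y) & forall x, H x -> H x^-1].

Definition subgroup_generated (G : groupType) (A : set G) : set G :=
  smallest (@is_subgroup G) A.

Definition centralizer (G : groupType) (x : G) : set G :=
  [set y | commute y x].

Definition left_cosets (G : groupType) (H : set G) : set (set G) :=
  [set [set g * h | h in H] | g in [set: G]].

Definition finite_index (G : groupType) (H : set G) : Prop :=
  finite_set (left_cosets H).

Definition almost_central (G : groupType) (x : G) : Prop :=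
  finite_index (centralizer x).

Definition involution (G : groupType) (x : G) : Prop := x <> 1 /\ x ^+ 2 = 1.

Definition ACI (G : groupType) : set G :=
  [set x | almost_central x /\ involution x].

(* The letter (s, false) stands for s, and (s, true) for its inverse. *)
Definition word (S : Type) : Type := seq (S * bool).

(* Equality in the group <S | R>: words modulo insertion and deletion of
   inverse pairs of letters and of relators. *)
Inductive word_equiv (S : Type) (R : set (word S)) : word S -> word S -> Prop :=
| word_equiv_refl u : word_equiv R u u
| word_equiv_sym u v : word_equiv R u v -> word_equiv R v u
| word_equiv_trans u v w :
    word_equiv R u v -> word_equiv R v w -> word_equiv R u w
| word_equiv_cancel u v s b :
    word_equiv R (u ++ [:: (s, b); (s, ~~ b)] ++ v) (u ++ v)
| word_equiv_relator u v r : R r -> word_equiv R (u ++ r ++ v) (u ++ v).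

Definition letter_eval (W : groupType) (S : Type) (i : S -> W)
    (x : S * bool) : W :=
  if x.2 then (i x.1)^-1 else i x.1.

Definition word_eval (W : groupType) (S : Type) (i : S -> W) (w : word S) : W :=
  \prod_(x <- w) letter_eval i x.

Definition is_presentation (W : groupType) (S : Type) (i : S -> W)
    (R : set (word S)) : Prop :=
  (forall g, exists w, word_eval i w = g) /\
  (forall u v, word_eval i u = word_eval i v <-> word_equiv R u v).

(* [None] encodes the label infinity. *)
Definition coxeter_relators (S : Type) (m : S -> S -> option nat) :
    set (word S) :=
  [set r | exists s t n, m s t = Some n /\
     r = flatten (nseq n [:: (s, false); (t, false)])].

Record coxeterSystem (W : groupType) (S : Type) := CoxeterSystem {
  cox_m : S -> S -> option nat;
  cox_gen : S -> W;
  cox_m_sym : forall s t, cox_m s t = cox_m t s;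
  cox_m_neq0 : forall s t, cox_m s t <> Some 0%N;
  cox_m_eq1 : forall s t, cox_m s t = Some 1%N <-> s = t;
  cox_presentation : is_presentation cox_gen (coxeter_relators cox_m)
}.

Definition cox_edge (W : groupType) (S : Type) (C : coxeterSystem W S)
    (s t : S) : Prop :=
  if cox_m C s t is Some n then (3 <= n)%N else True.

Definition graph_aut (W : groupType) (S : Type) (C : coxeterSystem W S)
    (tau : S -> S) : Prop :=
  [/\ bijective tau,
      forall s t, cox_edge C (tau s) (tau t) <-> cox_edge C s t &
      forall s t, cox_edge C s t -> cox_m C (tau s) (tau t) = cox_m C s t].

(* A homomorphism from G to Aut Gamma; each graph_act g being bijective,
   graph_actM implies graph_act 1 = id. *)
Record graphAction (W : groupType) (S : Type) (C : coxeterSystem W S)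
    (G : groupType) := GraphAction {
  graph_act :> G -> S -> S;
  graph_act_aut : forall g, graph_aut C (graph_act g);
  graph_actM : forall g h, graph_act (g * h) = graph_act g \o graph_act h
}.

Definition map_word (S : Type) (tau : S -> S) (w : word S) : word S :=
  [seq (tau x.1, x.2) | x <- w].

Definition cox_word (W : groupType) (S : Type) (C : coxeterSystem W S)
    (w : W) : word S :=
  sval (cid ((cox_presentation C).1 w)).

(* For tau in Aut Gamma this is the group automorphism of W extending tau: see
   [cox_ext_gen], [cox_extM], [cox_ext_bij] and [cox_ext_unique]. *)
Definition cox_ext (W : groupType) (S : Type) (C : coxeterSystem W S)
    (tau : S -> S) (w : W) : W :=
  word_eval (cox_gen C) (map_word tau (cox_word C w)).

Lemma word_eval_cat (W : groupType) (S : Type) (i : S -> W) (u v : word S) :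
  word_eval i (u ++ v) = word_eval i u * word_eval i v.
Proof. by rewrite /word_eval big_cat. Qed.

Lemma cox_wordK (W : groupType) (S : Type) (C : coxeterSystem W S) (w : W) :
  word_eval (cox_gen C) (cox_word C w) = w.
Proof. by rewrite /cox_word; case: cid. Qed.

Lemma graph_aut_m (W : groupType) (S : Type) (C : coxeterSystem W S)
    (tau : S -> S) (s t : S) :
  graph_aut C tau -> cox_m C (tau s) (tau t) = cox_m C s t.
Proof.
case=> /bij_inj tauI tauE taum.
have [|nE] := pselect (cox_edge C s t); first exact: taum.
have nE' : ~ cox_edge C (tau s) (tau t) by rewrite tauE.
have small a b : ~ cox_edge C a b -> cox_m C a b = Some 1%N \/ cox_m C a b = Some 2%N.
  rewrite /cox_edge; have := @cox_m_neq0 _ _ C a b.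
  by case: (cox_m C a b) => [[|[|[|n]]]|] //; auto.
have m1 : cox_m C (tau s) (tau t) = Some 1%N <-> cox_m C s t = Some 1%N.
  by rewrite !cox_m_eq1; split=> [/tauI|->].
have [E|E] := small _ _ nE; first by rewrite E; apply/m1.
have [/m1|->] := small _ _ nE'; last by rewrite E.
by rewrite E.
Qed.

Lemma word_equiv_map (W : groupType) (S : Type) (C : coxeterSystem W S)
    (tau : S -> S) (u v : word S) : graph_aut C tau ->
  word_equiv (coxeter_relators (cox_m C)) u v ->
  word_equiv (coxeter_relators (cox_m C)) (map_word tau u) (map_word tau v).
Proof.
move=> tauA; elim=> {u v} [u|u v _|u v w _ IHu _ IHv|u v s b|u v r].
- exact: word_equiv_refl.
- exact: word_equiv_sym.
- exact: word_equiv_trans IHu IHv.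
- by rewrite /map_word !map_cat; apply: word_equiv_cancel.
- move=> [s [t [n [mst ->]]]]; rewrite /map_word !map_cat.
  apply: word_equiv_relator; exists (tau s), (tau t), n.
  by rewrite graph_aut_m // map_flatten map_nseq.
Qed.

Lemma cox_ext_eval (W : groupType) (S : Type) (C : coxeterSystem W S)
    (tau : S -> S) (u : word S) : graph_aut C tau ->
  cox_ext C tau (word_eval (cox_gen C) u)
  = word_eval (cox_gen C) (map_word tau u).
Proof.
move=> tauA; apply/(cox_presentation C).2; apply: word_equiv_map => //.
by apply/(cox_presentation C).2; rewrite cox_wordK.
Qed.

Lemma cox_ext_gen (W : groupType) (S : Type) (C : coxeterSystem W S)
    (tau : S -> S) (s : S) : graph_aut C tau ->
  cox_ext C tau (cox_gen C s) = cox_gen C (tau s).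
Proof.
move=> tauA; have := cox_ext_eval [:: (s, false)] tauA.
by rewrite /word_eval !big_seq1.
Qed.

Lemma cox_extM (W : groupType) (S : Type) (C : coxeterSystem W S)
    (tau : S -> S) (v w : W) : graph_aut C tau ->
  cox_ext C tau (v * w) = cox_ext C tau v * cox_ext C tau w.
Proof.
move=> tauA; rewrite -(cox_wordK C v) -(cox_wordK C w) -word_eval_cat.
by rewrite !cox_ext_eval // /map_word map_cat word_eval_cat.
Qed.

Lemma cox_ext_comp (W : groupType) (S : Type) (C : coxeterSystem W S)
    (sigma tau : S -> S) (w : W) : graph_aut C sigma -> graph_aut C tau ->
  graph_aut C (sigma \o tau) ->
  cox_ext C (sigma \o tau) w = cox_ext C sigma (cox_ext C tau w).
Proof.
move=> sA tA stA; rewrite -(cox_wordK C w) !cox_ext_eval //.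
by rewrite /map_word -map_comp.
Qed.

Lemma cox_ext_id (W : groupType) (S : Type) (C : coxeterSystem W S) (w : W) :
  cox_ext C id w = w.
Proof.
rewrite /cox_ext /map_word -[RHS](cox_wordK C); congr word_eval.
by rewrite -[RHS]map_id; apply: eq_map; case.
Qed.

Lemma graph_aut_inv (W : groupType) (S : Type) (C : coxeterSystem W S)
    (tau taui : S -> S) : cancel tau taui -> cancel taui tau ->
  graph_aut C tau -> graph_aut C taui.
Proof.
move=> K K' tauA; have m s t : cox_m C (taui s) (taui t) = cox_m C s t.
  by rewrite -(graph_aut_m _ _ tauA) !K'.
by split=> [|s t|s t _]; [exists tau|rewrite /cox_edge m|].
Qed.

Lemma cox_ext_bij (W : groupType) (S : Type) (C : coxeterSystem W S)
    (tau : S -> S) : graph_aut C tau -> bijective (cox_ext C tau).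
Proof.
move=> tauA; have [[taui K K'] _ _] := tauA.
have tauiA := graph_aut_inv K K' tauA.
have E : taui \o tau = id by apply/funext.
have E' : tau \o taui = id by apply/funext.
have idA : graph_aut C id by split=> //; exists id.
by exists (cox_ext C taui) => w; rewrite -cox_ext_comp ?E ?E' ?cox_ext_id.
Qed.

Lemma cox_ext_unique (W : groupType) (S : Type) (C : coxeterSystem W S)
    (tau : S -> S) (phi : {multiplicative W -> W}) : graph_aut C tau ->
  (forall s, phi (cox_gen C s) = cox_gen C (tau s)) -> phi =1 cox_ext C tau.
Proof.
move=> tauA phis w; have phi1 : phi 1 = 1.
  by apply: (@mulgI _ (phi 1)); rewrite -gmulfM !mulg1.
have phiV x : phi x^-1 = (phi x)^-1.
  by apply: (@mulgI _ (phi x)); rewrite -gmulfM !mulgV.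
rewrite -(cox_wordK C w) cox_ext_eval // /map_word /word_eval big_map.
rewrite (big_morph phi (@gmulfM _ _ phi) phi1); apply: eq_bigr => -[s b] _.
by rewrite /letter_eval /=; case: b; rewrite ?phiV phis.
Qed.

Definition act_ext (W : groupType) (S : Type) (C : coxeterSystem W S)
    (G : groupType) (rho : graphAction C G) (g : G) : W -> W :=
  cox_ext C (rho g).

Lemma act_extM (W : groupType) (S : Type) (C : coxeterSystem W S)
    (G : groupType) (rho : graphAction C G) (g : G) (v w : W) :
  act_ext rho g (v * w) = act_ext rho g v * act_ext rho g w.
Proof. exact: cox_extM (graph_act_aut rho g). Qed.

Lemma act_ext_mul (W : groupType) (S : Type) (C : coxeterSystem W S)
    (G : groupType) (rho : graphAction C G) (g h : G) (w : W) :
  act_ext rho (g * h) w = act_ext rho g (act_ext rho h w).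
Proof.
rewrite /act_ext graph_actM cox_ext_comp //; try exact: graph_act_aut.
by rewrite -graph_actM; apply: graph_act_aut.
Qed.

Lemma act_ext1 (W : groupType) (S : Type) (C : coxeterSystem W S)
    (G : groupType) (rho : graphAction C G) (w : W) : act_ext rho 1 w = w.
Proof.
apply: (bij_inj (cox_ext_bij (graph_act_aut rho 1))).
by rewrite -/(act_ext _ _ _) -act_ext_mul mulg1.
Qed.

Lemma act_ext_one (W : groupType) (S : Type) (C : coxeterSystem W S)
    (G : groupType) (rho : graphAction C G) (g : G) : act_ext rho g 1 = 1.
Proof. by apply: (@mulgI _ (act_ext rho g 1)); rewrite -act_extM !mulg1. Qed.

Definition sdprod (W : groupType) (S : Type) (C : coxeterSystem W S)
    (G : groupType) (rho : graphAction C G) : Type := (W * G)%type.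

HB.instance Definition _ (W : groupType) (S : Type) (C : coxeterSystem W S)
    (G : groupType) (rho : graphAction C G) :=
  Choice.copy (sdprod rho) (W * G)%type.

Definition sdmul (W : groupType) (S : Type) (C : coxeterSystem W S)
    (G : groupType) (rho : graphAction C G) (x y : sdprod rho) : sdprod rho :=
  (x.1 * act_ext rho x.2 y.1, x.2 * y.2).

Definition sdone (W : groupType) (S : Type) (C : coxeterSystem W S)
    (G : groupType) (rho : graphAction C G) : sdprod rho := (1, 1).

Definition sdinv (W : groupType) (S : Type) (C : coxeterSystem W S)
    (G : groupType) (rho : graphAction C G) (x : sdprod rho) : sdprod rho :=
  (act_ext rho x.2^-1 x.1^-1, x.2^-1).

Lemma sdmulA (W : groupType) (S : Type) (C : coxeterSystem W S)
    (G : groupType) (rho : graphAction C G) : associative (@sdmul _ _ _ _ rho).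
Proof.
by move=> x y z; rewrite /sdmul /= act_extM act_ext_mul !mulgA.
Qed.

Lemma sdmul1 (W : groupType) (S : Type) (C : coxeterSystem W S)
    (G : groupType) (rho : graphAction C G) :
  left_id (sdone rho) (@sdmul _ _ _ _ rho).
Proof. by case=> w g; rewrite /sdmul /= act_ext1 !mul1g. Qed.

Lemma sd1mul (W : groupType) (S : Type) (C : coxeterSystem W S)
    (G : groupType) (rho : graphAction C G) :
  right_id (sdone rho) (@sdmul _ _ _ _ rho).
Proof. by case=> w g; rewrite /sdmul /= act_ext_one !mulg1. Qed.

Lemma sdmulV (W : groupType) (S : Type) (C : coxeterSystem W S)
    (G : groupType) (rho : graphAction C G) :
  left_inverse (sdone rho) (@sdinv _ _ _ _ rho) (@sdmul _ _ _ _ rho).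
Proof.
by case=> w g; rewrite /sdmul /sdinv /= -act_extM !mulVg act_ext_one.
Qed.

Lemma sdVmul (W : groupType) (S : Type) (C : coxeterSystem W S)
    (G : groupType) (rho : graphAction C G) :
  right_inverse (sdone rho) (@sdinv _ _ _ _ rho) (@sdmul _ _ _ _ rho).
Proof.
case=> w g; rewrite /sdmul /sdinv /= -act_ext_mul.
by rewrite !mulgV act_ext1 mulgV.
Qed.

HB.instance Definition _ (W : groupType) (S : Type) (C : coxeterSystem W S)
    (G : groupType) (rho : graphAction C G) :=
  isGroup.Build (sdprod rho) (@sdmulA _ _ _ _ rho) (@sdmul1 _ _ _ _ rho)
    (@sd1mul _ _ _ _ rho) (@sdmulV _ _ _ _ rho) (@sdVmul _ _ _ _ rho).

Definition sdprod_set (W : groupType) (S : Type) (C : coxeterSystem W S)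
    (G : groupType) (rho : graphAction C G) (A : set W) (B : set G) :
    set (sdprod rho) :=
  [set x | A x.1 /\ B x.2].
Arguments sdprod_set {W S C G} rho A B.

Definition parabolic (W : groupType) (S : Type) (C : coxeterSystem W S)
    (I : set S) : set W :=
  subgroup_generated [set cox_gen C s | s in I].

Definition graph_component (W : groupType) (S : Type) (C : coxeterSystem W S)
    (s : S) : set S :=
  [set t | clos_refl_trans S (cox_edge C) s t].

Definition irreducible_components (W : groupType) (S : Type)
    (C : coxeterSystem W S) : set (set W) :=
  [set parabolic C (graph_component C s) | s in [set: S]].

Definition finite_components (W : groupType) (S : Type)
    (C : coxeterSystem W S) : set (set W) :=
  [set K | irreducible_components C K /\ finite_set K].

Definition components_subgroup (W : groupType) (CC : set (set W)) : set W :=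
  subgroup_generated (\bigcup_(K in CC) K).

Definition rho_dagger (W : groupType) (S : Type) (C : coxeterSystem W S)
    (G : groupType) (rho : graphAction C G) (g : G) (K : set W) : set W :=
  [set act_ext rho g w | w in K].

Definition component_orbit (W : groupType) (S : Type) (C : coxeterSystem W S)
    (G : groupType) (rho : graphAction C G) (K : set W) : set (set W) :=
  [set rho_dagger rho g K | g in [set: G]].

Definition O_rho (W : groupType) (S : Type) (C : coxeterSystem W S)
    (G : groupType) (rho : graphAction C G) : set (set W) :=
  \bigcup_(O in [set component_orbit rho K | K in finite_components C]
                `&` @finite_set (set W)) O.

Definition G_rho (W : groupType) (S : Type) (C : coxeterSystem W S)
    (G : groupType) (rho : graphAction C G) : set G :=
  [set h | ACI h /\
     exists F : set (set W),
       [/\ finite_set F, F `<=` finite_components C &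
           forall K, irreducible_components C K -> ~ F K ->
             forall w, K w -> act_ext rho h w = w]].

(* Main.v *)
Require Import Defs.
From HB Require Import structures.
From Stdlib Require Import Relation_Operators.
From mathcomp Require Import all_boot.
From mathcomp Require Import ssralg ssrnum poly algC cyclotomic ring.
From mathcomp Require Import boolp classical_sets cardinality.

(* An isomorphism preserves the subgroup generated by the almost central
   involutions, so it suffices to show that in W x| G this subgroup is
   W(O_rho) x| <G_rho>.

   The finite conjugacy class of an almost central involution x generates, by
   Dietzmann's lemma, a finite normal subgroup Q.  Let t be a reflection of W.
   If no element of Q moves the base chamber across the wall of t, then t
   centralizes Q: otherwise t and some conjugate t ^ p with p in Q are two
   walls in the coset t Q, both crossed by every element of t Q, whereas some
   reflection of t Q crosses no wall of t Q but its own.  Moreover this property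
   of t passes to its W-conjugates.  So each simple reflection s either
   centralizes Q, or has all of its conjugates among the finitely many walls
   that Q crosses; call L the finite, G-stable set of those s of the second
   kind.

   For s in L, the same dichotomy applied to the normal closure of s shows that
   the irreducible component of s is finite.  Writing x = w g, the walls crossed
   by w show that w lies in W_L, and since x centralizes every s outside L, g
   fixes every s outside the components meeting L. *)

Local Open Scope classical_set_scope.
Local Open Scope group_scope.

Set Implicit Arguments.
Unset Strict Implicit.
Unset Printing Implicit Defensive.

(** * Generated subgroups, conjugacy classes and almost central involutions *)

Lemma sub_gen (G : groupType) (A : set G) : A `<=` subgroup_generated A.
Proof. by move=> x Ax K [_ AK]; apply: AK. Qed.

Lemma gen_min (G : groupType) (A K : set G) :
  is_subgroup K -> A `<=` K -> subgroup_generated A `<=` K.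
Proof. by move=> Ks AK x; apply. Qed.

Lemma gen_subgroup (G : groupType) (A : set G) :
  is_subgroup (subgroup_generated A).
Proof.
split=> [K [[]]|x y Ax Ay K KA|x Ax K KA] //.
  by case: (KA) => -[_ KM _] _; apply: KM; [apply: Ax|apply: Ay].
by case: (KA) => -[_ _ KV] _; apply: KV; apply: Ax.
Qed.

Lemma gen_normal (G : groupType) (A : set G) (g : G) :
  (forall x, A x -> A (x ^ g)) ->
  forall x, subgroup_generated A x -> subgroup_generated A (x ^ g).
Proof.
have [A1 AM AV] := gen_subgroup A.
move=> Ag; apply: gen_min; last by move=> x /Ag; apply: sub_gen.
split=> [|x y Ax Ay|x Ax]; first by rewrite conj1g.
  by rewrite conjMg; apply: AM.
by rewrite conjVg; apply: AV.
Qed.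

Lemma gen_involutions (G : groupType) (A : set G) :
  (forall x, A x -> x * x = 1) -> forall x, subgroup_generated A x ->
  exists2 l : seq G, (forall y, y \in l -> A y) & x = \prod_(y <- l) y.
Proof.
move=> A2; apply: gen_min; last first.
  by move=> x Ax; exists [:: x]; [move=> y; rewrite inE => /eqP->|rewrite big_seq1].
split=> [|x y [l lA ->] [l' l'A ->]|x [l lA ->]].
- by exists [::]; rewrite ?big_nil.
- exists (l ++ l'); last by rewrite big_cat.
  by move=> z; rewrite mem_cat => /orP[/lA|/l'A].
- elim: l lA => [|y l IHl] lA; first by exists [::]; rewrite // !big_nil invg1.
  have [z zl|l' l'A eql'] := IHl; first by apply: lA; rewrite inE zl orbT.
  exists (l' ++ [:: y]).
    move=> z; rewrite mem_cat inE => /orP[/l'A //|/eqP->].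
    by apply: lA; rewrite mem_head.
  rewrite big_cons invgM eql' big_cat big_seq1; congr (_ * _).
  by apply: mulg1_eq; apply: A2; apply: lA; rewrite mem_head.
Qed.

(* A repeated factor is cancelled by moving one occurrence next to the other,
   which conjugates the factors in between. *)
Lemma prod_involutions_uniq (G : groupType) (A : set G) :
  (forall x, A x -> x * x = 1) -> (forall x y, A x -> A y -> A (x ^ y)) ->
  forall l : seq G, (forall x, x \in l -> A x) ->
  exists l' : seq G, [/\ uniq l', forall x, x \in l' -> A x &
    \prod_(x <- l') x = \prod_(x <- l) x].
Proof.
move=> A2 AJ l; have [n] := ubnP (size l); elim: n l => // n IHn l ltn lA.
have [ul|] := boolP (uniq l); first by exists l.
suff dup : ~~ uniq l -> exists x a b c, l = a ++ x :: b ++ x :: c.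
  move=> /dup[x [a [b [c el]]]].
  have lx : A x by apply: lA; rewrite el mem_cat mem_head orbT.
  have [||l' [ul' l'A eql']] := IHn (a ++ [seq y ^ x | y <- b] ++ c).
  - move: ltn; rewrite el !(size_cat, size_map) /= !addnS !size_cat /= !addnS.
    exact: ltnW.
  - move=> y; rewrite !mem_cat => /or3P[ya|/mapP[z zb ->]|yc].
    + by apply: lA; rewrite el mem_cat ya.
    + by apply: AJ => //; apply: lA; rewrite el !(mem_cat, inE) zb !orbT.
    + by apply: lA; rewrite el !(mem_cat, inE) yc !orbT.
  - exists l'; split=> //; rewrite eql' el !big_cat big_map big_cons /=.
    congr (_ * _); rewrite big_cat big_cons /= -conjg_prod conjgE.
    by rewrite (mulg1_eq (A2 _ lx)) !mulgA.
elim: l {IHn ltn lA} => [|x l IHl] //=; rewrite negb_and negbK => /orP[|].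
  by case/path.splitPr => b c; exists x, [::], b, c.
by case/IHl => y [a [b [c ->]]]; exists y, (x :: a), b, c.
Qed.

Lemma finite_prods (G : groupType) (A : set G) (n : nat) : finite_set A ->
  finite_set [set x | exists l : seq G,
    [/\ size l <= n, forall y, y \in l -> A y & x = \prod_(y <- l) y]].
Proof.
move=> finA; elim: n => [|n IHn].
  apply: (@sub_finite_set _ _ [set 1]); last exact: finite_set1.
  by move=> x [[|y l] [sl _ ->]] //; rewrite big_nil.
set B := [set x | _] in IHn.
apply: (@sub_finite_set _ _ ([set 1] `|` [set x * y | x in A & y in B])).
  move=> x [[|y l] [sl lA ->]]; first by left; rewrite big_nil.
  right; exists y; first by apply: lA; rewrite mem_head.
  exists (\prod_(z <- l) z); last by rewrite big_cons.
  by exists l; split=> // z zl; apply: lA; rewrite inE zl orbT.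
by rewrite finite_setU; split; [exact: finite_set1|exact: finite_image2].
Qed.

(** Every element of the generated subgroup is a product of distinct members of [A], so its length
    is bounded by the size of [A]. *)
Lemma dietzmann (G : groupType) (A : set G) : finite_set A ->
  (forall x, A x -> x * x = 1) -> (forall x y, A x -> A y -> A (x ^ y)) ->
  finite_set (subgroup_generated A).
Proof.
move=> finA A2 AJ; have [s eA] := (finite_seqP A).1 finA.
apply: sub_finite_set (finite_prods (size s) finA).
move=> x /(gen_involutions A2)[l lA ->].
have [l' [ul' l'A <-]] := prod_involutions_uniq A2 AJ lA.
exists l'; split=> //; apply: uniq_leq_size => // y /l'A.
by rewrite eA.
Qed.

Definition conj_class (G : groupType) (x : G) : set G := range (conjg x).

Lemma left_coset_centralizer (G : groupType) (x g : G) :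
  [set g * h | h in centralizer x] = [set k | x ^ k^-1 = x ^ g^-1].
Proof.
apply/seteqP; split=> [_ [h hx <-]|k /= xk] /=.
  rewrite invgM conjgM; congr (_ ^ _).
  by rewrite conjgE invgK mulgA (hx : h * x = x * h) mulgK.
exists (g^-1 * k); last by rewrite mulVKg.
have {}xk : x ^ (g^-1 * k) = x by rewrite conjgM -xk conjgKV.
by rewrite /centralizer /= /commute [RHS]conjgC xk.
Qed.

Lemma almost_centralP (G : groupType) (x : G) :
  almost_central x <-> finite_set (conj_class x).
Proof.
rewrite /almost_central /finite_index; split=> fin.
  (* By [left_coset_centralizer] a coset is a fibre of [k] |-> [x ^ k^-1], so the value of [phi]
     does not depend on the representative picked; cosets are nonempty, so the default [1] is never
     reached. *)
  pose phi (A : set G) := x ^ (xget 1 A)^-1.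
  apply: sub_finite_set (finite_image phi fin).
  move=> _ [g _ <-]; exists [set g^-1 * h | h in centralizer x].
    by exists g^-1.
  rewrite left_coset_centralizer /phi.
  case: xgetP => [k _ /= ->|/(_ g^-1)/=]; first by rewrite invgK.
  by case.
apply: sub_finite_set (finite_image (fun y => [set k | x ^ k^-1 = y]) fin).
move=> _ [g _ <-]; exists (x ^ g^-1); first by exists g^-1.
by rewrite left_coset_centralizer.
Qed.

Lemma ACI_morph (G H : groupType) (f : UMagmaMorphism.type G H) (x : G) :
  bijective f -> ACI x -> ACI (f x).
Proof.
move=> [f' fK f'K]; rewrite /ACI /= /involution.
move=> -[/almost_centralP fin [x1 x2]]; split.
  apply/almost_centralP; apply: sub_finite_set (finite_image f fin).
  by move=> _ [h _ <-]; exists (x ^ f' h); rewrite ?gmulfJ ?f'K //; exists (f' h).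
split; last by rewrite -gmulfXn x2 gmulf1.
by move=> fx1; apply: x1; apply: (can_inj fK); rewrite fx1 gmulf1.
Qed.

Lemma gen_ACI_morph (G H : groupType) (f : UMagmaMorphism.type G H) :
  bijective f -> f @` subgroup_generated (@ACI G) `<=` subgroup_generated (@ACI H).
Proof.
move=> fb _ [x Ax <-]; move: x Ax; apply: gen_min; last first.
  by move=> x /(ACI_morph fb) fx; apply: sub_gen.
have [A1 AM AV] := gen_subgroup (@ACI H).
split=> [|x y Ax Ay|x Ax] /=; first by rewrite gmulf1.
  by rewrite gmulfM; apply: AM.
by rewrite gmulfV; apply: AV.
Qed.

Lemma gen_ACI_iso (G H : groupType) (f : UMagmaMorphism.type G H) :
  bijective f -> f @` subgroup_generated (@ACI G) = subgroup_generated (@ACI H).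
Proof.
move=> fb; apply/seteqP; split; first exact: gen_ACI_morph.
have [f' fK f'K] := fb.
(* The inverse map is packaged as a morphism so that the inclusion already proved applies to it. *)
have f'M := can2_gmulfM fK f'K.
pose f'Mix := isMultiplicative.Build H G f' f'M.
pose f'Mix1 := Multiplicative_isUMagmaMorphism.Build H G f' (can2_gmulf1 fK f'K).
pose g : UMagmaMorphism.type H G := HB.pack f' f'Mix f'Mix1.
move=> y Ay; exists (f' y); last exact: f'K.
by apply: (@gen_ACI_morph _ _ g); [exists f|exists y].
Qed.

(** * Finite subgroups and unmet walls *)

(* [N x t] says that the wall of [t] separates the base chamber from its image
   under [x]. *)
Definition wall_cocycle (G : groupType) (N : G -> G -> bool) : Prop :=
  forall x y t, N (x * y) t = N x t (+) N y (t ^ x).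

(* The last clause: among the walls crossed by a gallery from the base chamber
   to its image under [t], the first one in [D] is the wall of [s ^ p^-1]. *)
Definition reflection (G : groupType) (N : G -> G -> bool) (t : G) : Prop :=
  [/\ t * t = 1, N t t & forall D : set G, D t -> exists p s,
    [/\ D (s ^ p^-1), s * s = 1, forall x, N s x = (x == s) &
        forall x, D x -> N p x = false]].

Definition meets_wall (G : groupType) (N : G -> G -> bool) (Q : set G) (t : G) :
    Prop := exists2 q, Q q & N q t.

Lemma wall_cocycle1 (G : groupType) (N : G -> G -> bool) (t : G) :
  wall_cocycle N -> N 1 t = false.
Proof. by move=> NM; move: (NM 1 1 t); rewrite mulg1 conjg1; case: (N 1 t). Qed.

Lemma wall_cocycleV (G : groupType) (N : G -> G -> bool) (x t : G) :
  wall_cocycle N -> N x^-1 (t ^ x) = N x t.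
Proof.
move=> NM; move: (NM x x^-1 t); rewrite mulgV (wall_cocycle1 _ NM).
by case: (N x t); case: (N _ _).
Qed.

(** A gallery for the conjugate runs along [x], then [r], then back along the mirror image of the
    first stretch; the last term counts the crossings of that return. *)
Lemma wall_cocycleJ (G : groupType) (N : G -> G -> bool) (r x t : G) :
  wall_cocycle N ->
  N (r ^ x^-1) t = N x t (+) N r (t ^ x) (+) N x (t ^ (r ^ x^-1)).
Proof.
move=> NM; have -> : r ^ x^-1 = x * r * x^-1 by rewrite conjgE invgK mulgA.
rewrite NM NM -(@wall_cocycleV _ N x (t ^ _) NM); congr (_ (+) N _ _).
by rewrite -conjgM mulgVK.
Qed.

Lemma wall_separates_self (G : groupType) (N : G -> G -> bool) (t p : G) :
  wall_cocycle N -> N t t -> N (t ^ p) (t ^ p).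
Proof.
move=> NM Ntt; have := wall_cocycleJ t p^-1 (t ^ p) NM.
rewrite invgK conjgK Ntt => ->.
by rewrite [(t ^ p) ^ _]conjgE mulKg; case: (N _ _).
Qed.

(* Otherwise [t' := t ^ p] is another reflection of the coset [t Q], and both
   walls separate the base chamber from its image under any element of [t Q].
   But the first wall crossed by a gallery that lies in [t Q] is the only wall
   of [t Q] separating the base chamber from its mirror image. *)
Lemma unmet_reflection_central (G : groupType) (N : G -> G -> bool)
    (Q : set G) (t : G) :
  wall_cocycle N -> reflection N t -> is_subgroup Q ->
  (forall q, Q q -> Q (q ^ t)) -> ~ meets_wall N Q t ->
  forall p, Q p -> t ^ p = t.
Proof.
move=> NM [t2 Ntt gal] [Q1 QM QV] Qt nt p Qp.
have tV : t^-1 = t := mulg1_eq t2.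
have NQ q : Q q -> N q t = false.
  by move=> Qq; apply/negbTE/negP => Nq; apply: nt; exists q.
(* Write [q] as [p^-1 * (p * q)]: neither [p] nor [p * q] crosses the wall of [t]. *)
have NQ' q : Q q -> N q (t ^ p) = false.
  move=> Qq; have := NM p^-1 (p * q) (t ^ p).
  rewrite mulKg conjgK NQ ?addbF; last exact: QM.
  by rewrite wall_cocycleV // NQ.
pose D := [set t * q | q in Q].
have N1 r : D r -> N r t.
  by case=> q Qq <-; rewrite NM Ntt /conjg mulKg NQ.
have N2 r : D r -> N r (t ^ p).
  case=> q Qq <-.
  have -> : t * q = t ^ p * ((t ^ p)^-1 * t * q) by rewrite !mulgA mulgV mul1g.
  rewrite NM wall_separates_self // [(t ^ p) ^ _]conjgE mulKg NQ' //.
  apply: (QM) => //; have -> : (t ^ p)^-1 * t = p^-1 * p ^ t.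
    by rewrite -conjVg !conjgE tV !mulgA.
  by apply: (QM); [apply: (QV)|apply: (Qt)].
have Dt : D t by exists 1; rewrite ?mulg1.
have Dt' : D (t ^ p).
  exists (t * p^-1 * t * p); last by rewrite conjgE !mulgA t2 mul1g.
  by apply: (QM) => //; rewrite -{1}tV -mulgA; apply: (Qt); apply: (QV).
have [u [s [Dr s2 Ns Nu]]] := gal D Dt.
set r := s ^ u^-1 in Dr.
have r2 : r * r = 1 by rewrite -conjMg s2 conj1g.
have Dr' x : D x -> D (x ^ r).
  case: Dr => q Qq er [q' Qq' <-].
  have rV : r^-1 = r := mulg1_eq r2.
  exists (q * q' ^ t * q); first by do 2?apply: (QM) => //; apply: (Qt).
  by rewrite !conjgE rV -er tV !mulgA.
(* In [wall_cocycleJ] both outer terms vanish, since [u] crosses no wall of [D] and [r] normalizes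
   [D]; only the crossing of the wall of [s] is left. *)
have Nr x : D x -> N r x = (x == r).
  move=> Dx; rewrite wall_cocycleJ // Nu // Nu; last exact: Dr'.
  by rewrite Ns addbF /r (can2_eq (conjgK u) (conjgKV u)).
have := N1 _ Dr; rewrite Nr // => /eqP {2}->.
by have := N2 _ Dr; rewrite Nr // => /eqP.
Qed.

(** With [q' := q ^ v^-1], which commutes with [t], expand both sides of [q' * v = v * q] at [t]:
    the terms [N v t] cancel and leave [N q (t ^ v) = N q' t]. *)
Lemma unmet_reflection_conj (G : groupType) (N : G -> G -> bool)
    (Q : set G) (t v : G) :
  wall_cocycle N -> reflection N t -> is_subgroup Q ->
  (forall q, Q q -> Q (q ^ t)) -> (forall q, Q q -> Q (q ^ v^-1)) ->
  ~ meets_wall N Q t -> ~ meets_wall N Q (t ^ v).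
Proof.
move=> NM Nt Qs Qt Qv nt [q Qq]; apply/negP.
have Qq' := Qv _ Qq; set q' := q ^ v^-1 in Qq'.
have /eqP := unmet_reflection_central NM Nt Qs Qt nt Qq'.
rewrite /q' => /eqP tq'.
have := NM (q ^ v^-1) v t; rewrite tq' -conjgCV NM.
have -> : N (q ^ v^-1) t = false.
  by apply/negbTE/negP => Nq; apply: nt; exists (q ^ v^-1).
by case: (N v t); case: (N q _).
Qed.

(** * Words in the simple reflections *)

Lemma gen_mulgg (W : groupType) (S : Type) (C : coxeterSystem W S) (s : S) :
  cox_gen C s * cox_gen C s = 1.
Proof.
have : word_eval (cox_gen C) [:: (s, false); (s, false)] =
       word_eval (cox_gen C) [::].
  apply/(cox_presentation C).2.
  apply: (@word_equiv_relator _ _ [::] [::] [:: (s, false); (s, false)]).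
  by exists s, s, 1%N; split=> //; apply/cox_m_eq1.
by rewrite /word_eval !big_cons big_nil /letter_eval /= mulg1.
Qed.

Lemma gen_inv (W : groupType) (S : Type) (C : coxeterSystem W S) (s : S) :
  (cox_gen C s)^-1 = cox_gen C s.
Proof. exact: mulg1_eq (gen_mulgg C s). Qed.

Lemma gen_word (W : groupType) (S : Type) (C : coxeterSystem W S) (w : W) :
  exists l : seq S, w = \prod_(s <- l) cox_gen C s.
Proof.
exists (map fst (cox_word C w)); rewrite big_map -{1}(cox_wordK C w).
by apply: eq_bigr => -[s []] _; rewrite /letter_eval /= ?gen_inv.
Qed.

Lemma gen_braid (W : groupType) (S : Type) (C : coxeterSystem W S) (s t : S) n :
  cox_m C s t = Some n -> (cox_gen C s * cox_gen C t) ^+ n = 1.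
Proof.
move=> mst.
have : word_eval (cox_gen C) (flatten (nseq n [:: (s, false); (t, false)])) =
       word_eval (cox_gen C) [::].
  apply/(cox_presentation C).2.
  rewrite -[flatten _]cats0; apply: (@word_equiv_relator _ _ [::] [::]).
  by exists s, t, n.
rewrite [RHS]big_nil => <-; rewrite /word_eval big_flatten /=.
elim: n {mst} => [|n IHn] /=; first by rewrite big_nil.
by rewrite expgS IHn !big_cons big_nil /letter_eval /= mulg1.
Qed.

Lemma gen_commute (W : groupType) (S : Type) (C : coxeterSystem W S) (s t : S) :
  ~ cox_edge C s t -> commute (cox_gen C s) (cox_gen C t).
Proof.
rewrite /cox_edge; case mst : (cox_m C s t) => [[|[|[|n]]]|] // _.
- by case: (@cox_m_neq0 _ _ C s t).
- by have -> : s = t by apply/(cox_m_eq1 C).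
- have /mulg1_eq := gen_braid mst; rewrite invgM !gen_inv.
  by rewrite /commute => ->.
Qed.

(** The universal property of the presentation, phrased for actions. Words act letter by letter; the
    inverse flag can be ignored because generators act by involutions. *)
Lemma cox_action (W : groupType) (S : Type) (C : coxeterSystem W S)
    (M : Type) (a : S -> M -> M) :
  (forall s, involutive (a s)) ->
  (forall s t n, cox_m C s t = Some n -> forall x, iter n (a s \o a t) x = x) ->
  exists act : W -> M -> M,
    [/\ forall s x, act (cox_gen C s) x = a s x, forall x, act 1 x = x &
        forall v w x, act (v * w) x = act v (act w x)].
Proof.
move=> a2 am.
pose run (u : word S) x := foldr (fun l y => a l.1 y) x u.
have run_cat u v x : run (u ++ v) x = run u (run v x) by rewrite /run foldr_cat.
have run_eq u v : word_equiv (coxeter_relators (cox_m C)) u v -> run u =1 run v.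
  elim=> {u v} [u|u v _ IHu|u v w _ IHu _ IHv|u v s b|u v r Rr] x //.
  - by rewrite IHu IHv.
  - by rewrite !run_cat /= a2.
  - case: Rr => s [t [n [mst ->]]]; rewrite !run_cat; congr run.
    by rewrite -[RHS](am _ _ _ mst); elim: n {mst} => //= n <-.
exists (fun w => run (cox_word C w)); split=> [s x|x|v w x].
  have /run_eq -> // : word_equiv (coxeter_relators (cox_m C))
    (cox_word C (cox_gen C s)) [:: (s, false)].
  by apply/(cox_presentation C).2; rewrite cox_wordK /word_eval big_seq1.
  have /run_eq -> // : word_equiv (coxeter_relators (cox_m C))
    (cox_word C 1) [::].
  by apply/(cox_presentation C).2; rewrite cox_wordK /word_eval big_nil.
rewrite -run_cat; apply: run_eq; apply/(cox_presentation C).2.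
by rewrite word_eval_cat !cox_wordK.
Qed.

(** * The wall cocycle of a Coxeter group *)

(** [W] acts on signed elements: [s] conjugates the element and flips the sign exactly when the
    element is [s]. The cocycle records the sign change under [w^-1]; the inverse matches the order
    of factors in [wall_cocycle]. *)
Lemma exists_wall_cocycle (W : groupType) (S : Type) (C : coxeterSystem W S) :
  exists N : W -> W -> bool,
    wall_cocycle N /\ forall s x, N (cox_gen C s) x = (x == cox_gen C s).
Proof.
pose g := cox_gen C.
pose a s (x : W * bool) := (x.1 ^ g s, x.2 (+) (x.1 == g s)).
have a2 s : involutive (a s).
  move=> [x e]; rewrite /a /= -conjgM gen_mulgg conjg1; congr (_, _).
  have -> : (x ^ g s == g s) = (x == g s).
    by rewrite (can2_eq (conjgK _) (conjgKV _)) [g s ^ _]conjgE invgK mulgV mulg1.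
  by rewrite -addbA addbb addbF.
have am s t n : cox_m C s t = Some n -> forall x, iter n (a s \o a t) x = x.
  move=> mst [x e]; pose c := g t * g s.
  have cn : c ^+ n = 1 by apply: gen_braid; rewrite cox_m_sym.
  have tc : g t * c^-1 = c * g t by rewrite invgM !gen_inv mulgA.
  have tck k : g t * c ^- k = c ^+ k * g t.
    elim: k => [|k IHk]; first by rewrite !expg0 invg1 mulg1 mul1g.
    by rewrite expgSr invgM mulgA tc -mulgA IHk mulgA -expgS expgSr.
  (* Each round tests two further elements [c ^+ j * g t]. As [c ^+ n = 1], after [n] rounds the
     list of tests consists of two equal halves, whose flips cancel. *)
  have E k : iter k (a s \o a t) (x, e) =
      (x ^ (c ^+ k), e (+) \big[addb/false]_(0 <= j < k.*2) (x == c ^+ j * g t)).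
    elim: k => [|k IHk]; first by rewrite big_nil addbF expg0 conjg1.
    rewrite iterS IHk /a /= -!conjgM -expgSr doubleS !big_nat_recr //=.
    rewrite -!addbA; congr (_, _ (+) (_ (+) (_ (+) _))).
      rewrite (can2_eq (conjgK _) (conjgKV _)) conjgE invgK tck mulgA.
      by rewrite -expgnDr addnn.
    rewrite (can2_eq (conjgK _) (conjgKV _)) conjgE invgK invgM gen_inv.
    rewrite -/(g t) tck mulgA -(mulgA (c ^+ k) (g t)) -/c -expgSr mulgA.
    by rewrite -expgnDr addSn addnn.
  rewrite E cn conjg1 -addnn (big_cat_nat (n := n)) ?leq_addr //=.
  rewrite -{2}[n]add0n big_addn addnK.
  have -> : \big[addb/false]_(0 <= j < n) (x == c ^+ (j + n) * g t) =
      \big[addb/false]_(0 <= j < n) (x == c ^+ j * g t).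
    by apply: eq_bigr => j _; rewrite expgnDr cn mulg1.
  by rewrite addbb addbF.
have [act [act_gen act1 actM]] := cox_action a2 am.
have actE w x e : act w (x, e) = (x ^ w^-1, e (+) (act w (x, false)).2).
  have [l ->] := gen_word C w; elim: l x e => [|s l IHl] x e.
    by rewrite big_nil !act1 invg1 conjg1 addbF.
  rewrite big_cons !actM IHl !act_gen (IHl _ false) /a /= invgM gen_inv conjgM.
  by rewrite addbA.
exists (fun w x => (act w^-1 (x, false)).2); split=> [v w x|s x].
  by rewrite invgM actM actE /= [in LHS]actE /= invgK actE.
by rewrite gen_inv act_gen.
Qed.

Definition walls (W : groupType) (S : Type) (C : coxeterSystem W S) :
  W -> W -> bool := sval (cid (exists_wall_cocycle C)).

Lemma wallsM (W : groupType) (S : Type) (C : coxeterSystem W S) :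
  wall_cocycle (walls C).
Proof. by rewrite /walls; case: cid => N []. Qed.

Lemma walls_gen (W : groupType) (S : Type) (C : coxeterSystem W S) s x :
  walls C (cox_gen C s) x = (x == cox_gen C s).
Proof. by rewrite /walls; case: cid => N []. Qed.

Lemma walls1 (W : groupType) (S : Type) (C : coxeterSystem W S) x :
  walls C 1 x = false.
Proof. exact: wall_cocycle1 (wallsM C). Qed.

Lemma gen_neq1 (W : groupType) (S : Type) (C : coxeterSystem W S) (s : S) :
  cox_gen C s <> 1.
Proof.
by move=> s1; have := walls_gen C s (cox_gen C s); rewrite eqxx s1 walls1.
Qed.

(** A wall separating the two ends of a gallery is crossed at some step of it; [a] spells the
    gallery up to that step. *)
Lemma walls_word (W : groupType) (S : Type) (C : coxeterSystem W S)
    (l : seq S) (x : W) :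
  walls C (\prod_(s <- l) cox_gen C s) x -> exists a s b, l = a ++ s :: b /\
  x = cox_gen C s ^ (\prod_(r <- a) cox_gen C r)^-1.
Proof.
elim: l x => [|s l IHl] x; first by rewrite big_nil walls1.
rewrite big_cons wallsM walls_gen; case: (x =P cox_gen C s) => [-> _|_].
  by exists [::], s, l; rewrite big_nil invg1 conjg1.
rewrite addFb => /IHl[a [r [b [-> xr]]]]; exists (s :: a), r, b; split=> //.
by rewrite big_cons invgM conjgM -xr conjgK.
Qed.

Lemma finite_walls (W : groupType) (S : Type) (C : coxeterSystem W S) (w : W) :
  finite_set [set x | walls C w x].
Proof.
have [l ->] := gen_word C w; elim: l => [|s l IHl].
  apply: (@sub_finite_set _ _ set0) => // x /=.
  by rewrite big_nil walls1.
pose g := cox_gen C s.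
set p := \prod_(r <- l) cox_gen C r in IHl *.
apply: (@sub_finite_set _ _
  ([set g] `|` (conjg^~ g^-1) @` [set x | walls C p x])).
  move=> x /=; rewrite big_cons wallsM walls_gen.
  case: eqP => [-> _|_]; first by left.
  by rewrite addFb => wx; right; exists (x ^ g); rewrite ?conjgK.
rewrite finite_setU; split; first exact: finite_set1.
exact: finite_image.
Qed.

(** Follow the gallery spelled by [l] and stop just before its first crossing of a wall of [D], if
    there is one. For [reflection_gen] the gallery leads to a reflection in [D], which separates its
    own ends, so a crossing exists. *)
Lemma walls_first (W : groupType) (S : Type) (C : coxeterSystem W S)
    (D : set W) (l : seq S) :
  (exists p s, D (cox_gen C s ^ p^-1) /\ forall x, D x -> walls C p x = false)
  \/ forall x, D x -> walls C (\prod_(s <- l) cox_gen C s) x = false.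
Proof.
elim/last_ind: l => [|l s [fst|nD]]; [|by left|].
  by right=> x _; rewrite big_nil walls1.
set p := \prod_(r <- l) _ in nD.
have [Ds|nDs] := pselect (D (cox_gen C s ^ p^-1)); first by left; exists p, s.
right=> x Dx; rewrite -cats1 big_cat big_seq1 /= wallsM nD // walls_gen.
by apply/eqP => xs; apply: nDs; rewrite -xs conjgK.
Qed.

Lemma reflection_gen (W : groupType) (S : Type) (C : coxeterSystem W S)
    (s : S) (v : W) : reflection (walls C) (cox_gen C s ^ v).
Proof.
have tt : walls C (cox_gen C s ^ v) (cox_gen C s ^ v).
  by apply: wall_separates_self (wallsM C) _; rewrite walls_gen.
split=> // [|D Dt]; first by rewrite -conjMg gen_mulgg conj1g.
have [l tl] := gen_word C (cox_gen C s ^ v).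
have [[p [r [Dr Dp]]]|nD] := walls_first C D l; last by rewrite {1}tl nD in tt.
by exists p, (cox_gen C r); split=> // [|x]; rewrite ?gen_mulgg ?walls_gen.
Qed.

(* A word that crosses some wall twice can be shortened, so a shortest word for
   [w] crosses only walls of [walls C w]. *)
Lemma walls_support (W : groupType) (S : Type) (C : coxeterSystem W S)
    (L : set S) (w : W) :
  (forall s v, walls C w (cox_gen C s ^ v) -> L s) -> parabolic C L w.
Proof.
move=> wL; have [l] := gen_word C w.
have [P1 PM PV] := gen_subgroup [set cox_gen C s | s in L].
have [n] := ubnP (size l); elim: n l => // n IHn l ltn wl.
have [crossed|] := pselect (forall a s b, l = a ++ s :: b -> walls C w
    (cox_gen C s ^ (\prod_(r <- a) cox_gen C r)^-1)).
  have lL a b : l = a ++ b -> parabolic C L (\prod_(r <- b) cox_gen C r).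
    elim: b a => [|s b IHb] a el; first by rewrite big_nil.
    rewrite big_cons; apply: (PM).
      by apply: sub_gen; exists s => //; apply: wL (crossed _ _ _ el).
    by apply: (IHb (rcons a s)); rewrite cat_rcons.
  by rewrite wl; apply: (lL [::]).
move=> /existsNP[a /existsNP[s /existsNP[b /not_implyP[el nw]]]].
set p := \prod_(r <- a) cox_gen C r in nw; pose q := \prod_(r <- b) cox_gen C r.
have wE : w = p * (cox_gen C s * q) by rewrite wl el big_cat big_cons.
rewrite wE wallsM conjgKV wallsM walls_gen eqxx in nw.
rewrite [_ ^ cox_gen C s]conjgE mulKg in nw.
(* The wall crossed at [s] does not separate the ends, so it is crossed again in [p] or in [q].
   Deleting the two letters leaves the product unchanged. *)
have [/walls_word[a1 [t [a2 [ea et]]]]|np] :=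
  boolP (walls C p (cox_gen C s ^ p^-1)).
  apply: (IHn (a1 ++ a2 ++ b)).
    move: ltn; rewrite el ea !size_cat /= ?size_cat /= !addnS ?addSn -?addnA.
    exact: ltnW.
  rewrite wE mulgA (conjgCV p) et /p ea !big_cat big_cons /= conjgE invgK !mulgA.
  by rewrite mulgVK -(mulgA _ (cox_gen C t) (cox_gen C t)) gen_mulgg mulg1.
have /walls_word[b1 [t [b2 [eb et]]]] : walls C q (cox_gen C s).
  by apply/negPn/negP => nq; apply: nw; rewrite (negbTE np) (negbTE nq).
apply: (IHn (a ++ b1 ++ b2)).
  by move: ltn; rewrite el eb !size_cat /= ?size_cat /= !addnS; apply: ltnW.
rewrite wE {1}et /q eb !big_cat big_cons /= conjgE invgK !mulgA mulgVK.
by rewrite -(mulgA _ (cox_gen C t) (cox_gen C t)) gen_mulgg mulg1.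
Qed.

(** * The action of [G] on [W] and on its walls *)

Lemma act_ext_gen (W : groupType) (S : Type) (C : coxeterSystem W S)
    (G : groupType) (rho : graphAction C G) (g : G) (s : S) :
  act_ext rho g (cox_gen C s) = cox_gen C (rho g s).
Proof. exact: cox_ext_gen (graph_act_aut rho g). Qed.

Lemma act_extK (W : groupType) (S : Type) (C : coxeterSystem W S)
    (G : groupType) (rho : graphAction C G) (g : G) :
  cancel (act_ext rho g) (act_ext rho g^-1).
Proof. by move=> w; rewrite -act_ext_mul mulVg act_ext1. Qed.

Lemma act_extVK (W : groupType) (S : Type) (C : coxeterSystem W S)
    (G : groupType) (rho : graphAction C G) (g : G) :
  cancel (act_ext rho g^-1) (act_ext rho g).
Proof. by move=> w; rewrite -act_ext_mul mulgV act_ext1. Qed.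

Lemma act_extV (W : groupType) (S : Type) (C : coxeterSystem W S)
    (G : groupType) (rho : graphAction C G) (g : G) (w : W) :
  act_ext rho g w^-1 = (act_ext rho g w)^-1.
Proof.
by symmetry; apply: mulg1_eq; rewrite -act_extM mulgV act_ext_one.
Qed.

Lemma act_extJ (W : groupType) (S : Type) (C : coxeterSystem W S)
    (G : groupType) (rho : graphAction C G) (g : G) (v w : W) :
  act_ext rho g (v ^ w) = act_ext rho g v ^ act_ext rho g w.
Proof. by rewrite !conjgE !act_extM act_extV. Qed.

Lemma walls_act (W : groupType) (S : Type) (C : coxeterSystem W S)
    (G : groupType) (rho : graphAction C G) (g : G) (w t : W) :
  walls C (act_ext rho g w) (act_ext rho g t) = walls C w t.
Proof.
have [l ->] := gen_word C w; elim: l t => [|s l IHl] t.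
  by rewrite big_nil act_ext_one !walls1.
rewrite big_cons act_extM !wallsM -act_extJ IHl; congr (_ (+) _).
by rewrite act_ext_gen !walls_gen -act_ext_gen (can_eq (act_extK rho g)).
Qed.

(** * A linear representation *)

Import GRing.Theory Num.Theory.

(** The forms [f s + z * f t] and [f s + z^-1 * f t] are multiplied by [z ^+ 2] and [z ^- 2] under
    [rot]. The change of any value [f u] after [n] turns, times [z - z^-1], is a combination of the
    geometric sums of these two multipliers over a full period, which vanish. *)
Lemma iter_dihedral (F : fieldType) (S : Type) (s t : S) (cs ct : S -> F)
    (z : F) (n : nat) :
  (n.-primitive_root (z ^+ 2))%R -> (1 < n)%N ->
  (cs s = - 2)%R -> (ct t = - 2)%R ->
  (cs t = z + z^-1)%R -> (ct s = z + z^-1)%R ->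
  forall f, iter n ((fun f u => f u + f s * cs u)%R
    \o (fun f u => f u + f t * ct u)%R) f = f.
Proof.
move=> zn n_gt1 css ctt cst cts f.
have n_gt0 := ltnW n_gt1.
have z2n := prim_expr_order zn.
have z_neq0 : (z != 0)%R.
  by apply/eqP => z0; move/eqP: z2n; rewrite z0 !expr0n gtn_eqF //= eq_sym oner_eq0.
have z2_neq1 : (z ^+ 2 - 1 != 0)%R.
  rewrite subr_eq0 -[X in X == _]expr1 -(expr0 (z ^+ 2)%R).
  by rewrite (eq_prim_root_expr zn) mod0n modn_small.
set rot := _ \o _.
have step h : [/\ rot h s + z * rot h t = z ^+ 2 * (h s + z * h t),
    rot h s + z^-1 * rot h t = z^-1 ^+ 2 * (h s + z^-1 * h t) &
    forall u, (z - z^-1) * (rot h u - h u) =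
    (h s + z * h t) * (ct u + z * cs u) -
    (h s + z^-1 * h t) * (ct u + z^-1 * cs u)]%R.
  by rewrite /rot /= css ctt cst cts; split=> [||u]; field.
have iterE k : [/\ iter k rot f s + z * iter k rot f t
      = (z ^+ 2) ^+ k * (f s + z * f t),
    iter k rot f s + z^-1 * iter k rot f t
      = (z^-1 ^+ 2) ^+ k * (f s + z^-1 * f t) &
    forall u, (z - z^-1) * (iter k rot f u - f u) =
    (\sum_(j < k) (z ^+ 2) ^+ j) * (f s + z * f t) * (ct u + z * cs u) -
    (\sum_(j < k) (z^-1 ^+ 2) ^+ j) * (f s + z^-1 * f t) * (ct u + z^-1 * cs u)]%R.
  elim: k => [|k [IH1 IH2 IH3]].
    by split=> [||u]; rewrite /= ?expr0 ?mul1r // !big_ord0 subrr; ring.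
  have [st1 st2 st3] := step (iter k rot f).
  split=> [||u].
  - by rewrite iterS st1 IH1 (exprS (z ^+ 2)%R) mulrA.
  - by rewrite iterS st2 IH2 (exprS (z^-1 ^+ 2)%R) mulrA.
  rewrite !big_ord_recr /= -[rot _ u](subrK (iter k rot f u)) -addrA mulrDr st3.
  by rewrite IH3 IH1 IH2; ring.
apply/funext => u; apply/eqP; rewrite -subr_eq0.
have d_neq0 : (z - z^-1 != 0)%R.
  apply: contraNneq z2_neq1 => d0.
  by rewrite -(mulfV z_neq0) expr2 -mulrBr d0 mulr0.
have sum0 (x : F) : (x - 1 != 0)%R -> (x ^+ n = 1)%R ->
    (\sum_(j < n) x ^+ j = 0)%R.
  move=> x1 xn; apply: (mulfI x1); rewrite mulr0.
  by rewrite -subrX1 xn subrr.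
have [_ _ /(_ u)] := iterE n; rewrite !sum0 //.
- by rewrite !mul0r subrr => /eqP; rewrite mulf_eq0 (negbTE d_neq0).
- apply: contraNneq z2_neq1 => /eqP; rewrite exprVn subr_eq0 invr_eq1.
  by rewrite subr_eq0.
- by rewrite exprVn exprVn z2n invr1.
Qed.

(* With [z] a primitive root of unity of order [2 n], the sum [z + z^-1] plays
   the role of [2 cos (pi / n)]; for the label infinity any nonzero value
   does. *)
Definition cox_coef (o : option nat) : algC :=
  if o is Some n then
    (let z := sval (C_prim_root_exists (ltn0Sn n.*2.-1)) in z + z^-1)%R
  else 1%R.

Lemma cox_coefE (n : nat) : (0 < n)%N -> exists z : algC,
  n.*2.-primitive_root%R z /\ cox_coef (Some n) = (z + z^-1)%R.
Proof.
move=> n_gt0; rewrite /cox_coef; case: C_prim_root_exists => z /= zn.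
by exists z; split=> //; rewrite prednK ?double_gt0 // in zn.
Qed.

Lemma cox_coef1 : cox_coef (Some 1%N) = (- 2)%R.
Proof.
have [z [z2 ->]] := @cox_coefE 1 isT.
have z1 : (z != 1)%R.
  by rewrite -[z in X in X == _]expr1 -(expr0 z) (eq_prim_root_expr z2).
have /eqP := prim_expr_order z2; rewrite sqrf_eq1 (negbTE z1) /= => /eqP->.
by rewrite invrN1; ring.
Qed.

(** A zero sum would give [z ^+ 2 = -1], hence [z ^+ 4 = 1], although [z] has order at least 6. *)
Lemma cox_coef_neq0 (n : nat) : (3 <= n)%N -> (cox_coef (Some n) != 0)%R.
Proof.
move=> n3; have [z [zn ->]] := @cox_coefE n (ltnW (ltnW n3)).
have z_neq0 : (z != 0)%R.
  by rewrite (prim_root_eq0 zn) double_eq0 -lt0n ltnW // ltnW.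
apply/eqP => zz; have : (z ^+ 4 == z ^+ 0)%R.
  have z2 : (z ^+ 2 = - 1)%R.
    apply/eqP; rewrite -subr_eq0 opprK expr2.
    by rewrite -(mulfV z_neq0) -mulrDr zz mulr0.
  by rewrite expr0 (exprM z 2 2) z2 sqrrN expr1n.
rewrite (eq_prim_root_expr zn) mod0n modn_small //.
by rewrite -(ltn_double 2 n) in n3.
Qed.

(** Up to the choice of roots of unity and of the value for the label infinity, this is the dual of
    the geometric representation: [f] lists the values of a linear form on the simple roots. *)
Lemma cox_linear (W : groupType) (S : Type) (C : coxeterSystem W S) :
  exists act : W -> (S -> algC) -> (S -> algC),
  [/\ forall s f u, act (cox_gen C s) f u
        = (f u + f s * cox_coef (cox_m C s u))%R,
      forall f, act 1 f = f & forall v w f, act (v * w) f = act v (act w f)].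
Proof.
pose a s (f : S -> algC) u := (f u + f s * cox_coef (cox_m C s u))%R.
have mss s : cox_m C s s = Some 1%N by apply/cox_m_eq1.
have a2 s : involutive (a s).
  by move=> f; apply/funext => u; rewrite /a mss cox_coef1; ring.
have am s t n : cox_m C s t = Some n -> forall f, iter n (a s \o a t) f = f.
  move=> mst f; have := @cox_m_neq0 _ _ C s t.
  case: n mst => [|[|n]] mst; first by rewrite mst.
    by have <- : s = t by [apply/(cox_m_eq1 C)]; move=> _; apply: a2.
  have [z [zn zE]] := @cox_coefE n.+2 isT.
  move=> _; apply: (@iter_dihedral _ _ s t _ _ z); rewrite ?mss ?cox_coef1 //.
  - have dn : (n.+2 %| n.+2.*2)%N by rewrite -mul2n dvdn_mull.
    by have := dvdn_prim_root zn dn; rewrite -mul2n mulnK.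
  - by rewrite mst.
  - by rewrite cox_m_sym mst.
have [act [actg act1 actM]] := cox_action a2 am.
by exists act; split=> // s f u; rewrite actg.
Qed.

(** On the indicator function of [s], the generator [s] changes the value at [s] to -1, while any
    other generator fixes the function. *)
Lemma gen_inj (W : groupType) (S : Type) (C : coxeterSystem W S) :
  injective (cox_gen C).
Proof.
move=> s t st; have [act [actg _ _]] := cox_linear C.
apply: contrapT => nst; pose f u : algC := (asbool (u = s))%:R%R.
have mss : cox_m C s s = Some 1%N by apply/cox_m_eq1.
have := actg s f s; rewrite st actg mss cox_coef1 /f.
rewrite (asboolT (erefl s)) (asboolF (nesym nst)) mul0r addr0 mul1r => /eqP.
by rewrite -subr_eq0 opprD opprK addrA subrr add0r pnatr_eq0.
Qed.

(** The indicator function of [r] is fixed by the parabolic subgroup of [L], whereas the conjugate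
    turns its value at [r] into [1 - c ^+ 2], where [c] is the nonzero coefficient of the edge. *)
Lemma gen_conj_notin_parabolic (W : groupType) (S : Type)
    (C : coxeterSystem W S) (L : set S) (q r : S) :
  ~ L r -> cox_edge C r q -> ~ parabolic C L (cox_gen C q ^ cox_gen C r).
Proof.
move=> nLr rq; have [act [actg act1 actM]] := cox_linear C.
have mss s : cox_m C s s = Some 1%N by apply/cox_m_eq1.
have nqr : q <> r by move=> qr; move: rq; rewrite qr /cox_edge mss.
pose f u : algC := (asbool (u = r))%:R%R.
have fr : (f r = 1)%R by rewrite /f asboolT.
have fq : (f q = 0)%R by rewrite /f asboolF.
have fixL : parabolic C L `<=` [set w | act w f = f].
  apply: gen_min => [|_ [s Ls <-]]; last first.
    apply/funext => u; rewrite actg.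
    have -> : (f s = 0)%R by rewrite /f asboolF // => sr; apply: nLr; rewrite -sr.
    by rewrite mul0r addr0.
  split=> [|v w /= fv fw|w /= fw] /=; first exact: act1.
    by rewrite actM fw fv.
  by rewrite -{1}fw -actM mulVg act1.
move=> /fixL /= /(congr1 (@^~ r)); rewrite conjgE gen_inv !actM.
rewrite !actg !mss !cox_coef1 fr fq cox_m_sym [cox_m C q r]cox_m_sym.
set c := cox_coef _ => /eqP; apply/negP.
have c_neq0 : (c != 0)%R.
  move: rq; rewrite /c /cox_edge; case: (cox_m C r q) => [n|_].
    exact: cox_coef_neq0.
  exact: oner_neq0.
rewrite -subr_eq0 [X in (X != 0)%R](_ : _ = - c ^+ 2)%R; last by ring.
by rewrite oppr_eq0 expf_neq0.
Qed.

(** * Finite components *)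

(** Being unmet spreads from one [V]-conjugate of [t] to all of them, and an unmet reflection
    centralizes [Q]. The group [V] is separate from [G] because it will be either [W] itself or the
    copy of [W] inside the semidirect product. *)
Lemma reflection_dichotomy (G : groupType) (N : G -> G -> bool)
    (Q V : set G) (t : G) :
  wall_cocycle N -> is_subgroup Q -> is_subgroup V ->
  (forall v, V v -> reflection N (t ^ v)) ->
  (forall q v, Q q -> V v -> Q (q ^ v)) -> (forall v, V v -> V (t ^ v)) ->
  (forall v, V v -> meets_wall N Q (t ^ v)) \/
  (forall q, Q q -> t ^ q = t) /\ (forall v, V v -> ~ meets_wall N Q (t ^ v)).
Proof.
move=> NM Qs [V1 VM VV] tN QV tV.
have [|/existsNP[v /not_implyP[Vv nv]]] :=
  pselect (forall v, V v -> meets_wall N Q (t ^ v)); first by left.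
have nV u : V u -> ~ meets_wall N Q (t ^ u).
  move=> Vu; rewrite -(mulVKg v u) conjgM.
  have Vvu : V (v^-1 * u) by apply: VM => //; apply: VV.
  apply: (unmet_reflection_conj NM (tN _ Vv) Qs) => // q Qq; apply: QV => //.
    exact: tV.
  exact: VV.
right; split=> //; rewrite -[t]conjg1.
apply: (unmet_reflection_central NM (tN _ V1) Qs); last exact: nV.
by move=> q Qq; apply: QV => //; apply: tV.
Qed.

Lemma gen_closed (G H : groupType) (A : set G) (K : set H) (f : G -> H) :
  is_subgroup K -> {morph f : x y / x * y} -> (forall x, A x -> K (f x)) ->
  forall x, subgroup_generated A x -> K (f x).
Proof.
move=> [K1 KM KV] fM AK.
have f1 : f 1 = 1 by apply: (@mulgI _ (f 1)); rewrite -fM !mulg1.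
apply: gen_min => //; split=> [|x y Kx Ky|x Kx] /=; first by rewrite f1.
  by rewrite fM; apply: KM.
suff -> : f x^-1 = (f x)^-1 by apply: KV.
by symmetry; apply: mulg1_eq; rewrite -fM mulgV.
Qed.

Lemma cox_full (W : groupType) (S : Type) (C : coxeterSystem W S) (K : set W) :
  is_subgroup K -> (forall s, K (cox_gen C s)) -> forall w, K w.
Proof.
move=> [K1 KM _] Ks w; have [l ->] := gen_word C w.
elim: l => [|s l IHl]; first by rewrite big_nil.
by rewrite big_cons; apply: KM.
Qed.

Lemma walls_parabolic (W : groupType) (S : Type) (C : coxeterSystem W S)
    (L : set S) (w x : W) :
  parabolic C L w -> walls C w x -> parabolic C L x.
Proof.
have [P1 PM PV] := gen_subgroup [set cox_gen C s | s in L].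
have PJ y v : parabolic C L v -> parabolic C L (y ^ v) -> parabolic C L y.
  move=> Lv Lyv; rewrite -(conjgK v y) conjgE invgK.
  by apply: (PM) => //; apply: (PM) => //; apply: PV.
pose K := [set v | parabolic C L v /\ forall x, walls C v x -> parabolic C L x].
suff: parabolic C L `<=` K by move=> LK /LK[_]; apply.
apply: gen_min => [|_ [s Ls <-]]; last first.
  split=> [|y]; first by apply: sub_gen; exists s.
  by rewrite walls_gen => /eqP->; apply: sub_gen; exists s.
split=> [|u v [Lu uL] [Lv vL]|v [Lv vL]]; first by split=> // y; rewrite walls1.
  split=> [|y]; first exact: PM.
  rewrite wallsM; case: (boolP (walls C u y)) => [/uL //|_].
  by rewrite addFb => /vL; apply: PJ.
split=> [|y]; first exact: PV.
rewrite -(conjgKV v y) (wall_cocycleV _ _ (wallsM C)) => /vL Ly.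
by rewrite conjgE; apply: (PM) => //; [apply: PV|apply: PM].
Qed.

Lemma cox_edge_sym (W : groupType) (S : Type) (C : coxeterSystem W S) (s t : S) :
  cox_edge C s t -> cox_edge C t s.
Proof. by rewrite /cox_edge cox_m_sym. Qed.

Lemma conj_class_closed (G : groupType) (x y z : G) :
  conj_class x y -> conj_class x (y ^ z).
Proof. by case=> u _ <-; exists (u * z); rewrite ?conjgM. Qed.

Lemma conj_class_involution (G : groupType) (x y : G) :
  x * x = 1 -> conj_class x y -> y * y = 1.
Proof. by move=> x2 [u _ <-]; rewrite -conjMg x2 conj1g. Qed.

Lemma finite_meets_wall (G : groupType) (N : G -> G -> bool) (Q : set G) :
  finite_set Q -> (forall q, finite_set [set t | N q t]) ->
  finite_set (meets_wall N Q).
Proof.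
move=> finQ finN; have := bigcup_finite finQ (fun q _ => finN q).
by apply: sub_finite_set => t [q Qq qt]; exists q.
Qed.

(* [P], the normal closure of [s], is finite. Neighbours of a generator all of
   whose conjugates are met by [P] have the same property: otherwise they
   centralize [P], hence permute the walls met by [P], which all lie in a
   parabolic subgroup not containing them. *)
Lemma finite_component (W : groupType) (S : Type) (C : coxeterSystem W S)
    (s : S) : finite_set (conj_class (cox_gen C s)) ->
  finite_set (parabolic C (graph_component C s)).
Proof.
set g := cox_gen C => fin; pose P := subgroup_generated (conj_class (g s)).
have Ps : is_subgroup P := gen_subgroup _.
have finP : finite_set P.
  apply: dietzmann => // x; first exact: conj_class_involution (gen_mulgg C s).
  by move=> y xs _; apply: conj_class_closed.
have PJ q v : P q -> P (q ^ v).
  by apply: gen_normal => x; apply: conj_class_closed.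
pose met := meets_wall (walls C) P.
have finmet : finite_set met by apply: finite_meets_wall finP (finite_walls C).
have dich r : (forall v, met (g r ^ v)) \/
    (forall q, P q -> g r ^ q = g r) /\ (forall v, ~ met (g r ^ v)).
  have [||||||rm|[rP rm]] := @reflection_dichotomy _ (walls C) P setT (g r).
  - exact: wallsM.
  - by [].
  - by [].
  - by move=> v _; apply: reflection_gen.
  - by move=> q v Pq _; apply: PJ.
  - by [].
  - by left=> v; apply: rm.
  - by right; split=> // v; apply: rm.
pose L := [set r | forall v, met (g r ^ v)].
have PL q : P q -> parabolic C L q.
  move=> Pq; apply: walls_support => r v qrv; have [//|[_ /(_ v)[]]] := dich r.
  by exists q.
have compL : graph_component C s `<=` L.
  suff step r t : cox_edge C r t -> L r -> L t.
    move=> t /= st; have : L s.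
      have [//|[_ /(_ 1)[]]] := dich s.
      exists (g s); last by rewrite walls_gen conjg1.
      by apply: sub_gen; exists 1; rewrite ?conjg1.
    elim: st => [a b|//|a b c _ IHab _ IHbc La]; first exact: step.
    exact: IHbc (IHab La).
  move=> rt Lr; have [//|[tP tm]] := dich t; exfalso.
  have [q Pq qr] := Lr 1; rewrite conjg1 in qr.
  have tq : t <> r.
    by move=> tr; apply: (tm 1); rewrite tr; apply: Lr.
  have neq : (g r == g t) = false by apply/eqP => e; apply: tq; rewrite (gen_inj e).
  have qt : q ^ (g t)^-1 = q.
    by rewrite conjgE invgK mulgA (conjgC (g t)) tP // mulgK.
  (* As [t] commutes with [q] and differs from [r], a crossing of the wall of [r] by [q] forces one
     of the wall of [r ^ t]. *)
  have := wall_cocycleJ q (g t) (g r) (wallsM C).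
  rewrite qt qr !walls_gen (can2_eq (conjgK q) (conjgKV q)) neq.
  have -> : g t ^ q^-1 = g t by apply: tP; case: Ps => _ _; apply.
  rewrite neq addFb addbF => /esym qrt.
  have : parabolic C L (g r ^ g t) by apply: walls_parabolic qrt; apply: PL.
  apply: gen_conj_notin_parabolic; last exact: cox_edge_sym.
  by move=> Lt; apply: (tm 1); apply: Lt.
(* All conjugates of generators of the component are met by [P], hence finite in number, and
   Dietzmann's lemma applies a second time. *)
pose Z := [set x | exists2 r, graph_component C s r & conj_class (g r) x].
suff : finite_set (subgroup_generated Z).
  apply: sub_finite_set; apply: gen_min; first exact: gen_subgroup.
  by move=> _ [r sr <-]; apply: sub_gen; exists r => //; exists 1; rewrite ?conjg1.
apply: dietzmann.
- by apply: sub_finite_set finmet => x [r /compL Lr [v _ <-]]; apply: Lr.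
- by move=> x [r _]; apply: conj_class_involution (gen_mulgg C r).
- by move=> x y [r sr rx] _; exists r => //; apply: conj_class_closed.
Qed.

(** * Components under the action of G, and the semidirect product *)

Lemma graph_component_eq (W : groupType) (S : Type) (C : coxeterSystem W S)
    (s t : S) :
  graph_component C s t -> graph_component C t = graph_component C s.
Proof.
move=> st; apply/seteqP; split=> r /= rt; first exact: rt_trans st rt.
apply: rt_trans rt; elim: st => [a b ab|a|a b c _ IHab _ IHbc].
- by apply: rt_step; apply: cox_edge_sym.
- exact: rt_refl.
- exact: rt_trans IHbc IHab.
Qed.

(** A generator [r] either is joined to the generator [t] of the component, and so lies in it too,
    or commutes with [t]. *)
Lemma component_normal (W : groupType) (S : Type) (C : coxeterSystem W S)
    (s : S) (v w : W) :
  parabolic C (graph_component C s) w ->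
  parabolic C (graph_component C s) (w ^ v).
Proof.
set K := parabolic C _; have Ks : is_subgroup K := gen_subgroup _.
have [K1 KM KV] := Ks; have [l ->] := gen_word C v.
elim: l w => [|r l IHl] w; first by rewrite big_nil conjg1.
rewrite big_cons conjgM => Kw; apply: IHl.
apply: (@gen_closed _ _ _ _ (conjg^~ (cox_gen C r)) Ks _ _ w Kw).
  by move=> x y; rewrite conjMg.
move=> _ [t st <-].
have Kt : K (cox_gen C t) by apply: sub_gen; exists t.
have [tr|ntr] := pselect (cox_edge C t r).
  have Kr : K (cox_gen C r).
    by apply: sub_gen; exists r => //; apply: rt_trans st (rt_step _ _ _ _ tr).
  by rewrite conjgE; apply: (KM); [apply: KV|apply: KM].
by rewrite conjgE (gen_commute ntr) mulKg.
Qed.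

Lemma act_ext_parabolic (W : groupType) (S : Type) (C : coxeterSystem W S)
    (G : groupType) (rho : graphAction C G) (g : G) (L : set S) (w : W) :
  parabolic C L w -> parabolic C (rho g @` L) (act_ext rho g w).
Proof.
apply: gen_closed => [|x y|_ [s Ls <-]]; first exact: gen_subgroup.
  exact: act_extM.
by rewrite act_ext_gen; apply: sub_gen; exists (rho g s) => //; exists s.
Qed.

Lemma graph_actK (W : groupType) (S : Type) (C : coxeterSystem W S)
    (G : groupType) (rho : graphAction C G) (g : G) :
  cancel (rho g) (rho g^-1).
Proof.
by move=> s; apply: (@gen_inj _ _ C); rewrite -!act_ext_gen act_extK.
Qed.

Lemma graph_act_component (W : groupType) (S : Type) (C : coxeterSystem W S)
    (G : groupType) (rho : graphAction C G) (g : G) (s t : S) :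
  graph_component C s t -> graph_component C (rho g s) (rho g t).
Proof.
elim=> [a b ab|a|a b c _ IHab _ IHbc].
- by apply: rt_step; have [_ e _] := graph_act_aut rho g; apply/e.
- exact: rt_refl.
- exact: rt_trans IHab IHbc.
Qed.

Lemma rho_dagger_component (W : groupType) (S : Type) (C : coxeterSystem W S)
    (G : groupType) (rho : graphAction C G) (g : G) (s : S) :
  rho_dagger rho g (parabolic C (graph_component C s)) =
  parabolic C (graph_component C (rho g s)).
Proof.
have sub h t w : parabolic C (graph_component C t) w ->
    parabolic C (graph_component C (rho h t)) (act_ext rho h w).
  move=> /(@act_ext_parabolic _ _ _ _ rho h) hw; apply: gen_min hw.
    exact: gen_subgroup.
  move=> _ [_ [r tr <-] <-]; apply: sub_gen; exists (rho h r) => //.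
  exact: graph_act_component.
apply/seteqP; split=> [_ [w sw <-]|w gw]; first exact: sub.
exists (act_ext rho g^-1 w); last exact: act_extVK.
by rewrite -(graph_actK rho g s); apply: sub.
Qed.

Lemma O_rhoP (W : groupType) (S : Type) (C : coxeterSystem W S)
    (G : groupType) (rho : graphAction C G) (K : set W) :
  O_rho rho K <-> exists s, [/\ K = parabolic C (graph_component C s),
    finite_set K & finite_set (component_orbit rho K)].
Proof.
split=> [[_ [[_ [[s _ <-] fin] <-] finO] [g _ <-]]|[s [-> fin finO]]].
  exists (rho g s); rewrite -rho_dagger_component; split=> //.
    exact: finite_image.
  apply: sub_finite_set finO => _ [h _ <-]; exists (h * g) => //.
  by rewrite !rho_dagger_component graph_actM.
exists (component_orbit rho (parabolic C (graph_component C s))).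
  by split=> //; exists (parabolic C (graph_component C s)) => //; split=> //; exists s.
exists 1 => //; rewrite /rho_dagger.
by under eq_imagel do rewrite act_ext1; rewrite image_id.
Qed.

(** * Computations in the semidirect product *)

Lemma sdprodM (W : groupType) (S : Type) (C : coxeterSystem W S)
    (G : groupType) (rho : graphAction C G) (x y : sdprod rho) :
  x * y = (x.1 * act_ext rho x.2 y.1, x.2 * y.2).
Proof. by []. Qed.

Lemma sdprodV (W : groupType) (S : Type) (C : coxeterSystem W S)
    (G : groupType) (rho : graphAction C G) (x : sdprod rho) :
  x^-1 = (act_ext rho x.2^-1 x.1^-1, x.2^-1).
Proof. by []. Qed.

Lemma sdprod_conj (W : groupType) (S : Type) (C : coxeterSystem W S)
    (G : groupType) (rho : graphAction C G) (x y : sdprod rho) :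
  x ^ y = (act_ext rho y.2^-1 (y.1^-1 * x.1 * act_ext rho x.2 y.1), x.2 ^ y.2).
Proof.
by rewrite !conjgE !sdprodM sdprodV /= -act_extM !mulgA.
Qed.

Definition inl_sd (W : groupType) (S : Type) (C : coxeterSystem W S)
    (G : groupType) (rho : graphAction C G) (w : W) : sdprod rho := (w, 1).

Definition inr_sd (W : groupType) (S : Type) (C : coxeterSystem W S)
    (G : groupType) (rho : graphAction C G) (g : G) : sdprod rho := (1, g).

Lemma inl_sdM (W : groupType) (S : Type) (C : coxeterSystem W S)
    (G : groupType) (rho : graphAction C G) : {morph inl_sd rho : v w / v * w}.
Proof. by move=> v w; rewrite sdprodM /= act_ext1 mulg1. Qed.

Lemma inr_sdM (W : groupType) (S : Type) (C : coxeterSystem W S)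
    (G : groupType) (rho : graphAction C G) : {morph inr_sd rho : g h / g * h}.
Proof. by move=> g h; rewrite sdprodM /= act_ext_one mulg1. Qed.

Lemma inl_sdJ (W : groupType) (S : Type) (C : coxeterSystem W S)
    (G : groupType) (rho : graphAction C G) (w : W) (x : sdprod rho) :
  inl_sd rho w ^ x = inl_sd rho (act_ext rho x.2^-1 (w ^ x.1)).
Proof. by rewrite sdprod_conj /= act_ext1 conj1g conjgE mulgA. Qed.

Lemma sdprod_split (W : groupType) (S : Type) (C : coxeterSystem W S)
    (G : groupType) (rho : graphAction C G) (x : sdprod rho) :
  x = inl_sd rho x.1 * inr_sd rho x.2.
Proof. by case: x => w g; rewrite sdprodM /= act_ext1 mulg1 mul1g. Qed.

(** The displacements [w^-1 * act_ext rho h w] are the [W]-parts of the [W]-conjugates of [h]; [g]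
    carries those of [h] to those of [h ^ g]. *)
Lemma act_extJV (W : groupType) (S : Type) (C : coxeterSystem W S)
    (G : groupType) (rho : graphAction C G) (g h : G) (w : W) :
  act_ext rho g^-1 (w^-1 * act_ext rho h w) =
  (act_ext rho g^-1 w)^-1 * act_ext rho (h ^ g) (act_ext rho g^-1 w).
Proof.
by rewrite act_extM act_extV -!act_ext_mul conjgE -!mulgA mulgV mulg1.
Qed.

(** The elements of square 1 in the members of [F] generate a finite normal subgroup [A], and every
    [w] is [b * a] with [a] in [A] and [b] fixed by [h]. So [w] and [a] have the same
    displacement. *)
Lemma finite_displacements (W : groupType) (S : Type) (C : coxeterSystem W S)
    (G : groupType) (rho : graphAction C G) (h : G) (F : set (set W)) :
  finite_set F -> F `<=` finite_components C ->
  (forall K, irreducible_components C K -> ~ F K ->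
     forall w, K w -> act_ext rho h w = w) ->
  finite_set (range (fun w => w^-1 * act_ext rho h w)).
Proof.
move=> finF Fcomp Fh.
pose X := [set x | exists2 K, F K & K x /\ x * x = 1].
have XJ x v : X x -> X (x ^ v).
  move=> [K FK [Kx x2]]; exists K => //.
  rewrite -conjMg x2 conj1g; split=> //.
  by have [[s _ eK] _] := Fcomp _ FK; move: Kx; rewrite -eK; apply: component_normal.
pose A := subgroup_generated X.
have finA : finite_set A.
  apply: dietzmann => [|x [K _ []] //|x y Xx _]; last exact: XJ.
  have finU : finite_set (\bigcup_(K in F) K).
    by apply: bigcup_finite => // K /Fcomp[].
  by apply: sub_finite_set finU => x [K FK [Kx _]]; exists K.
have [A1 AM AV] : is_subgroup A := gen_subgroup X.
have AJ a v : A a -> A (a ^ v) by apply: gen_normal => x; apply: XJ.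
pose V := [set w | exists a b, [/\ A a, act_ext rho h b = b & w = b * a]].
have VT : forall w, V w.
  apply: (cox_full (C := C)).
    split=> [|v w [a [b [Aa hb ->]]] [a' [b' [Aa' hb' ->]]]|w [a [b [Aa hb ->]]]].
    - by exists 1, 1; rewrite act_ext_one mulg1.
    - exists (a ^ b' * a'), (b * b'); rewrite act_extM hb hb'; split=> //.
        by apply: AM => //; apply: AJ.
      by rewrite conjgE !mulgA mulgK.
    - exists (a^-1 ^ b^-1), b^-1; rewrite act_extV hb; split=> //.
        by apply: AJ; apply: AV.
      by rewrite conjgE invgM invgK !mulgA mulVg mul1g.
  move=> s; pose K := parabolic C (graph_component C s).
  have Ks : K (cox_gen C s) by apply: sub_gen; exists s => //; apply: rt_refl.
  have [FK|nFK] := pselect (F K).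
    exists (cox_gen C s), 1; rewrite act_ext_one mul1g; split=> //.
    by apply: sub_gen; exists K => //; rewrite gen_mulgg.
  exists 1, (cox_gen C s); rewrite mulg1; split=> //.
  by apply: Fh nFK _ Ks; exists s.
apply: sub_finite_set (finite_image (fun a => a^-1 * act_ext rho h a) finA).
move=> _ [w _ <-]; have [a [b [Aa hb ->]]] := VT w; exists a => //.
by rewrite act_extM hb invgM -!mulgA mulKg.
Qed.

(** All conjugates lie in the union of the orbit of the component: finitely many finite groups, each
    normal in [W]. *)
Lemma ACI_gen (W : groupType) (S : Type) (C : coxeterSystem W S)
    (G : groupType) (rho : graphAction C G) (s : S) :
  O_rho rho (parabolic C (graph_component C s)) ->
  ACI (inl_sd rho (cox_gen C s)).
Proof.
set K := parabolic C _ => /O_rhoP[_ [_ finK finO]].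
have Ks : K (cox_gen C s) by apply: sub_gen; exists s => //; apply: rt_refl.
split; last first.
  split; first by move=> /(congr1 fst) s1; apply: (gen_neq1 (C := C) s1).
  by rewrite expg2 -inl_sdM gen_mulgg.
apply/almost_centralP.
have finU : finite_set (\bigcup_(L in component_orbit rho K) L).
  by apply: bigcup_finite => // _ [g _ <-]; apply: finite_image.
apply: sub_finite_set (finite_image (inl_sd rho) finU).
move=> _ [x _ <-]; rewrite inl_sdJ.
exists (act_ext rho x.2^-1 (cox_gen C s ^ x.1)) => //.
exists (rho_dagger rho x.2^-1 K); first by exists x.2^-1.
by exists (cox_gen C s ^ x.1) => //; apply: component_normal.
Qed.

(** A conjugate has a [G]-part among the finitely many conjugates [k] of [h], and its [W]-part is a
    displacement of [k]. *)
Lemma ACI_G_rho (W : groupType) (S : Type) (C : coxeterSystem W S)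
    (G : groupType) (rho : graphAction C G) (h : G) :
  G_rho rho h -> ACI (inr_sd rho h).
Proof.
move=> [[/almost_centralP finh [h1 h2]] [F [finF Fcomp Fh]]]; split; last first.
  by split=> [[]//|]; rewrite expg2 -inr_sdM -expg2 h2.
apply/almost_centralP.
have finY := finite_displacements finF Fcomp Fh.
pose D k := range (fun w => w^-1 * act_ext rho k w).
have finU : finite_set
    (\bigcup_(k in conj_class h) (fun y => (y, k) : sdprod rho) @` D k).
  apply: bigcup_finite => // _ [g _ <-]; apply: finite_image.
  apply: sub_finite_set (finite_image (act_ext rho g^-1) finY).
  move=> _ [w _ <-]; exists ((act_ext rho g w)^-1 * act_ext rho h (act_ext rho g w)).
    by exists (act_ext rho g w).
  by rewrite act_extJV act_extK.
apply: sub_finite_set finU => _ [[w g] _ <-].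
rewrite sdprod_conj /= mulg1 act_extJV; exists (h ^ g); first by exists g.
by eexists; [exists (act_ext rho g^-1 w)|].
Qed.

Lemma components_subgroup_act (W : groupType) (S : Type) (C : coxeterSystem W S)
    (G : groupType) (rho : graphAction C G) (g : G) (w : W) :
  components_subgroup (O_rho rho) w ->
  components_subgroup (O_rho rho) (act_ext rho g w).
Proof.
apply: gen_closed => [|x y|x [K [_ [[K0 K0P <-] finO] [h _ <-]] Kx]].
- exact: gen_subgroup.
- exact: act_extM.
apply: sub_gen; exists (rho_dagger rho g (rho_dagger rho h K0)); last by exists x.
exists (component_orbit rho K0); first by split=> //; exists K0.
exists (g * h) => //.
apply/seteqP; split=> [_ [v Kv <-]|_ [_ [v Kv <-] <-]].
  by exists (act_ext rho h v); rewrite ?act_ext_mul //; exists v.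
by exists v; rewrite ?act_ext_mul.
Qed.

Lemma sdprod_set_subgroup (W : groupType) (S : Type) (C : coxeterSystem W S)
    (G : groupType) (rho : graphAction C G) (A : set W) (B : set G) :
  is_subgroup A -> is_subgroup B ->
  (forall g w, A w -> A (act_ext rho g w)) -> is_subgroup (sdprod_set rho A B).
Proof.
move=> [A1 AM AV] [B1 BM BV] Aact.
split=> [|x y [Ax Bx] [Ay By]|x [Ax Bx]]; first by split.
  by split; [apply: AM => //; apply: Aact|apply: BM].
by split; [apply: Aact; apply: AV|apply: BV].
Qed.

(** Only elements of [W] carry walls, and [(w, g)] crosses the walls that [w] crosses, because [g]
    fixes the base chamber. *)
Definition walls_sd (W : groupType) (S : Type) (C : coxeterSystem W S)
    (G : groupType) (rho : graphAction C G) (x t : sdprod rho) : bool :=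
  (t.2 == 1) && walls C x.1 t.1.

Lemma walls_sdM (W : groupType) (S : Type) (C : coxeterSystem W S)
    (G : groupType) (rho : graphAction C G) : wall_cocycle (@walls_sd _ _ _ _ rho).
Proof.
move=> x y t; rewrite /walls_sd; have [t1|nt1] := eqVneq t.2 1.
  have -> : t = inl_sd rho t.1 by rewrite [LHS]sdprod_split t1 mulg1.
  rewrite inl_sdJ /= eqxx /= wallsM; congr (_ (+) _).
  by rewrite -(walls_act rho x.2 y.1) act_extVK.
by rewrite sdprod_conj /= conjg_eq1 (negbTE nt1).
Qed.

Lemma reflection_sd (W : groupType) (S : Type) (C : coxeterSystem W S)
    (G : groupType) (rho : graphAction C G) (t : W) :
  reflection (walls C) t -> reflection (@walls_sd _ _ _ _ rho) (inl_sd rho t).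
Proof.
move=> [t2 tt gal]; split; first by rewrite -inl_sdM t2.
  by rewrite /walls_sd eqxx.
move=> D Dt; have [p [s [Ds s2 Ns Np]]] := gal [set w | D (inl_sd rho w)] Dt.
have inlV w : (inl_sd rho w)^-1 = inl_sd rho w^-1.
  by apply: mulg1_eq; rewrite -inl_sdM mulgV.
exists (inl_sd rho p), (inl_sd rho s); split=> [||[w g]|[w g] Dw].
- by rewrite inlV inl_sdJ /= invg1 act_ext1.
- by rewrite -inl_sdM s2.
- by rewrite /walls_sd /= Ns -pair_eqE /= andbC.
- rewrite /walls_sd /=; case: eqP => //= g1; apply: Np.
  by rewrite /= /inl_sd -g1.
Qed.

(** * The subgroup generated by the almost central involutions *)

Lemma sdprod_set_sub_gen_ACI (W : groupType) (S : Type) (C : coxeterSystem W S)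
    (G : groupType) (rho : graphAction C G) :
  sdprod_set rho (components_subgroup (O_rho rho)) (subgroup_generated (G_rho rho))
  `<=` subgroup_generated (@ACI (sdprod rho)).
Proof.
have As := gen_subgroup (@ACI (sdprod rho)); have [_ AM AV] := As.
move=> x [Ox Gx]; rewrite (sdprod_split x); apply: AM; last first.
  apply: (gen_closed As (@inr_sdM _ _ _ _ rho) _ Gx) => h /ACI_G_rho.
  exact: sub_gen.
apply: (gen_closed As (@inl_sdM _ _ _ _ rho) _ Ox) => w [K OK Kw].
have [s [eK _ _]] := (O_rhoP _ _).1 OK; rewrite eK in Kw.
apply: (gen_closed As (@inl_sdM _ _ _ _ rho) _ Kw) => _ [t st <-].
by apply: sub_gen; apply: ACI_gen; rewrite (graph_component_eq st) -eK.
Qed.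

Lemma conj_class_subgroup (G : groupType) (x : G) :
  ACI x -> [/\ finite_set (subgroup_generated (conj_class x)),
    subgroup_generated (conj_class x) x &
    forall q g, subgroup_generated (conj_class x) q ->
      subgroup_generated (conj_class x) (q ^ g)].
Proof.
move=> [/almost_centralP fin [_ x2]]; split=> [||q g].
- apply: dietzmann => // y; first by apply: conj_class_involution; rewrite -expg2.
  by move=> z xy _; apply: conj_class_closed.
- by apply: sub_gen; exists 1; rewrite ?conjg1.
- by apply: gen_normal => y; apply: conj_class_closed.
Qed.

Lemma ACI_sub_sdprod_set (W : groupType) (S : Type) (C : coxeterSystem W S)
    (G : groupType) (rho : graphAction C G) :
  @ACI (sdprod rho) `<=`
  sdprod_set rho (components_subgroup (O_rho rho)) (subgroup_generated (G_rho rho)).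
Proof.
move=> x xACI; have [finQ Qx QJ] := conj_class_subgroup xACI.
set Q := subgroup_generated _ in finQ Qx QJ.
have Qs : is_subgroup Q := gen_subgroup _.
pose gen := cox_gen C.
pose met (t : W) := meets_wall (@walls_sd _ _ _ _ rho) Q (inl_sd rho t).
have finmet : finite_set met.
  have finU : finite_set (\bigcup_(q in Q) [set t | walls C q.1 t]).
    by apply: bigcup_finite => // q _; apply: finite_walls.
  apply: sub_finite_set finU => t [q Qq]; rewrite /walls_sd eqxx => qt.
  by exists q.
have inlJ (t v : W) : inl_sd rho t ^ inl_sd rho v = inl_sd rho (t ^ v).
  by rewrite inl_sdJ /= invg1 act_ext1.
have inlV w : (inl_sd rho w)^-1 = inl_sd rho w^-1.
  by apply: mulg1_eq; rewrite -inl_sdM mulgV.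
have dich s : (forall v, met (gen s ^ v)) \/
    (forall q, Q q -> inl_sd rho (gen s) ^ q = inl_sd rho (gen s)) /\
    (forall v, ~ met (gen s ^ v)).
  have [||||||sm|[sQ sm]] := @reflection_dichotomy _ (@walls_sd _ _ _ _ rho) Q
    (range (inl_sd rho)) (inl_sd rho (gen s)).
  - exact: walls_sdM.
  - exact: Qs.
  - split=> [|_ _ [v _ <-] [w _ <-]|_ [v _ <-]]; first by exists 1.
      by exists (v * w); rewrite ?inl_sdM.
    by exists v^-1; rewrite ?inlV.
  - by move=> _ [v _ <-]; rewrite inlJ; apply: reflection_sd; apply: reflection_gen.
  - by move=> q v Qq _; apply: QJ.
  - by move=> _ [v _ <-]; rewrite inlJ; exists (gen s ^ v).
  - by left=> v; rewrite /met -inlJ; apply: sm; exists v.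
  - by right; split=> // v; rewrite /met -inlJ; apply: sm; exists v.
pose L := [set s | forall v, met (gen s ^ v)].
have finL : finite_set L.
  have : finite_set (gen @^-1` met).
    by apply: finite_preimage finmet => s t _ _; apply: gen_inj.
  by apply: sub_finite_set => s /(_ 1); rewrite conjg1.
have Lact g s : L s -> L (rho g s).
  have metact t : met t -> met (act_ext rho g t).
    move=> [q Qq]; rewrite /walls_sd eqxx /= => qt.
    (* This conjugate has [W]-part [act_ext rho g q.1], which crosses the image under [g] of the
       wall of [t]. *)
    exists (q ^ inr_sd rho g^-1); first exact: QJ.
    rewrite /walls_sd eqxx sdprod_conj /= invgK invg1 mul1g act_ext_one mulg1.
    by rewrite walls_act.
  move=> Ls v; rewrite /gen -act_ext_gen -(act_extVK rho g v) -act_extJ.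
  by apply: metact; apply: Ls.
pose K s := parabolic C (graph_component C s).
have finK s : L s -> finite_set (K s).
  move=> Ls; apply: finite_component; apply: sub_finite_set finmet.
  by move=> _ [v _ <-]; apply: Ls.
have Kgen s : K s (gen s) by apply: sub_gen; exists s => //; apply: rt_refl.
(* The orbit of [K s] consists of components [K r] with [r] in the finite [G]-stable set [L]. *)
have OK s : L s -> O_rho rho (K s).
  move=> Ls; apply/O_rhoP; exists s; split=> //; first exact: finK.
  apply: sub_finite_set (finite_image K finL) => _ [g _ <-].
  by exists (rho g s); [apply: Lact|rewrite rho_dagger_component].
have Lx : parabolic C L x.1.
  apply: walls_support => s v xs; have [//|[_ /(_ v)[]]] := dich s.
  by exists x => //; rewrite /walls_sd eqxx.
split.
  apply: gen_min Lx => [|_ [s Ls <-]]; first exact: gen_subgroup.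
  by apply: sub_gen; exists (K s) => //; apply: OK.
have [/almost_centralP finx [x1 x2]] := xACI.
have g2 : x.2 * x.2 = 1 by have := congr1 snd x2; rewrite expg2.
have [->|/eqP g1] := eqVneq x.2 1; first by case: (gen_subgroup (G_rho rho)).
apply: sub_gen; split.
  split=> //; apply/almost_centralP.
  apply: sub_finite_set (finite_image snd finx) => _ [h _ <-].
  by exists (x ^ inr_sd rho h); [exists (inr_sd rho h)|rewrite sdprod_conj].
exists (K @` L); split; first exact: finite_image.
  by move=> _ [s Ls <-]; split; [exists s|apply: finK].
move=> _ [s _ <-] nL.
have nLt t : graph_component C s t -> ~ L t.
  by move=> st Lt; apply: nL; exists t => //; rewrite /K (graph_component_eq st).
apply: gen_min => [|_ [t st <-]] /=.
  split=> [|v w /= gv gw|v /= gv] /=; first exact: act_ext_one.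
    by rewrite act_extM gv gw.
  by rewrite act_extV gv.
have nt := nLt _ st; have [//|[tQ _]] := dich t.
(* [x] centralizes [t], and so does its [W]-part, which is a product of generators from other
   components; hence the [G]-part fixes [t]. *)
have := congr1 fst (tQ _ Qx); rewrite inl_sdJ /=.
have -> : gen t ^ x.1 = gen t.
  suff : parabolic C L `<=` [set w | gen t ^ w = gen t] by apply.
  apply: gen_min => [|_ [r Lr <-]] /=.
    split=> [|v w /= tv tw|v /= tv] /=; first exact: conjg1.
      by rewrite conjgM tv.
    by rewrite -{1}tv conjgK.
  rewrite conjgE (_ : gen t * _ = cox_gen C r * gen t) ?mulKg //.
  apply: gen_commute => tr; apply: nLt Lr.
  exact: rt_trans st (rt_step _ _ _ _ tr).
by rewrite -/(gen t) => {1}<-; rewrite act_extVK.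
Qed.

Lemma gen_ACI_sdprod (W : groupType) (S : Type) (C : coxeterSystem W S)
    (G : groupType) (rho : graphAction C G) :
  subgroup_generated (@ACI (sdprod rho)) =
  sdprod_set rho (components_subgroup (O_rho rho)) (subgroup_generated (G_rho rho)).
Proof.
apply/seteqP; split; last exact: sdprod_set_sub_gen_ACI.
apply: gen_min; last exact: ACI_sub_sdprod_set.
apply: sdprod_set_subgroup; try exact: gen_subgroup.
exact: components_subgroup_act.
Qed.

Theorem theorem3p2
    (W1 W2 : groupType) (S1 S2 : Type)
    (C1 : coxeterSystem W1 S1) (C2 : coxeterSystem W2 S2)
    (G1 G2 : groupType)
    (rho1 : graphAction C1 G1) (rho2 : graphAction C2 G2)
    (f : {multiplicative sdprod rho1 -> sdprod rho2})
    (f_bij : bijective f) :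
  f @` (sdprod_set rho1 (components_subgroup (O_rho rho1))
                        (subgroup_generated (G_rho rho1)))
  = sdprod_set rho2 (components_subgroup (O_rho rho2))
                    (subgroup_generated (G_rho rho2)).
Proof.
have f1 : f 1 = 1 by apply: (@mulgI _ (f 1)); rewrite -gmulfM !mulg1.
(* [gen_ACI_iso] takes a unital morphism, so [f] is repackaged with the derived equation [f1]. *)
pose h : sdprod rho1 -> sdprod rho2 := f.
pose hM := isMultiplicative.Build (sdprod rho1) (sdprod rho2) h (@gmulfM _ _ f).
pose h1 := Multiplicative_isUMagmaMorphism.Build (sdprod rho1) (sdprod rho2) h f1.
pose fU : UMagmaMorphism.type (sdprod rho1) (sdprod rho2) := HB.pack h hM h1.
rewrite -!gen_ACI_sdprod.
exact: (@gen_ACI_iso _ _ fU).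
Qed.
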